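(* Let $N$ be a connected one-dimensional manifold. For any group morphism $\varphi : \mathrm{Homeo}_{0}(\mathbb{R}) \rightarrow \mathrm{Homeo}(N)$, there exists a closed set $K \subset N$ such that: (1) the set $K$ is pointwise fixed under every homeomorphism in $\varphi(\mathrm{Homeo}_{0}(\mathbb{R}))$; (2) for any connected component $I$ of $N - K$, there exists a homeomorphism $h_{I} : \mathbb{R} \rightarrow I$ such that $$\forall f \in \mathrm{Homeo}_{0}(\mathbb{R}), \quad \varphi(f)_{|I} = h_{I} f h_{I}^{-1}.$$
   Context: Manifolds are topological manifolds without boundary. $\mathrm{Homeo}(N)$ denotes the group of all homeomorphisms of $N$. The support of a homeomorphism $f$ of a manifold $M$ is the closure of $\{x \in M : f(x) \neq x\}$. $\mathrm{Homeo}_{0}(M)$ denotes the identity component of the group of compactly supported homeomorphisms of $M$ for the strong topology, i.e. the group of compactly supported homeomorphisms of $M$ that are isotopic to the identity through an isotopy supported in a compact set; here $M=\mathbb{R}$. Groups are considered as abstract (discrete) groups: no continuity of morphisms is assumed. *)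

(* Defs.v *)
From HB Require Import structures.
From mathcomp Require Import all_boot all_order all_algebra.
From mathcomp Require Import all_classical all_reals all_analysis.

Set Implicit Arguments.
Unset Strict Implicit.
Unset Printing Implicit Defensive.

Import Order.TTheory GRing.Theory Num.Theory.
Import numFieldNormedType.Exports.

Local Open Scope classical_set_scope.
Local Open Scope ring_scope.

(* A subset [A : set T], used as a type, carries the subspace topology (see
   [subtype_topology]); so [homeo R A] are the homeomorphisms from R onto A. *)
Record homeo (X Y : topologicalType) := HomeoPack {
  homeo_fun :> X -> Y;
  homeo_inv : Y -> X;
  homeo_continuous : continuous homeo_fun;
  homeo_inv_continuous : continuous homeo_inv;
  homeo_funK : cancel homeo_fun homeo_inv;
  homeo_invK : cancel homeo_inv homeo_fun
}.

Lemma homeo_eqP (X Y : topologicalType) (f g : homeo X Y) : f =1 g -> f = g.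
Proof.
case: f g => [f f' cf cf' fK f'K] [g g' cg cg' gK g'K] /= /funext efg.
subst g.
have efg' : f' = g' by apply/funext => y; rewrite -{1}(g'K y) fK.
subst g'.
by congr HomeoPack; exact: Prop_irrelevance.
Qed.

Definition Homeo (M : topologicalType) : Type := homeo M M.
Identity Coercion homeo_of_Homeo : Homeo >-> homeo.

Section HomeoGroup.
Context {M : topologicalType}.
Implicit Types f g : Homeo M.

HB.instance Definition _ := gen_eqMixin (Homeo M).
HB.instance Definition _ := gen_choiceMixin (Homeo M).

Definition homeo_id : Homeo M :=
  @HomeoPack M M idfun idfun (fun _ => cvg_id) (fun _ => cvg_id)
    (fun _ => erefl) (fun _ => erefl).

Definition homeo_sym f : Homeo M :=
  HomeoPack (@homeo_inv_continuous _ _ f) (@homeo_continuous _ _ f)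
    (@homeo_invK _ _ f) (@homeo_funK _ _ f).

Lemma comp_continuous (f g : M -> M) :
  continuous f -> continuous g -> continuous (f \o g).
Proof. by move=> cf cg x; apply: continuous_comp; [exact: cg|exact: cf]. Qed.

Definition homeo_comp f g : Homeo M :=
  HomeoPack
    (comp_continuous (@homeo_continuous _ _ f) (@homeo_continuous _ _ g))
    (comp_continuous (@homeo_inv_continuous _ _ g)
       (@homeo_inv_continuous _ _ f))
    (can_comp (@homeo_funK _ _ f) (@homeo_funK _ _ g))
    (can_comp (@homeo_invK _ _ g) (@homeo_invK _ _ f)).

Lemma homeo_compA : associative homeo_comp.
Proof. by move=> f g h; apply: homeo_eqP. Qed.
Lemma homeo_comp1 : left_id homeo_id homeo_comp.
Proof. by move=> f; apply: homeo_eqP. Qed.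
Lemma homeo_compr1 : right_id homeo_id homeo_comp.
Proof. by move=> f; apply: homeo_eqP. Qed.
Lemma homeo_compV : left_inverse homeo_id homeo_sym homeo_comp.
Proof. by move=> f; apply: homeo_eqP => x /=; rewrite homeo_funK. Qed.
Lemma homeo_comprV : right_inverse homeo_id homeo_sym homeo_comp.
Proof. by move=> f; apply: homeo_eqP => x /=; rewrite homeo_invK. Qed.

HB.instance Definition _ := isGroup.Build (Homeo M)
  homeo_compA homeo_comp1 homeo_compr1 homeo_compV homeo_comprV.

Lemma homeo_mulE f g x : (f * g)%g x = f (g x). Proof. by []. Qed.
Lemma homeo_oneE x : (1%g : Homeo M) x = x. Proof. by []. Qed.
Lemma homeo_invE f x : (f^-1)%g x = homeo_inv f x. Proof. by []. Qed.

Definition homeo_support f : set M := closure [set x | f x != x].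

Lemma homeo_support1 : homeo_support 1%g = set0.
Proof.
rewrite /homeo_support (_ : [set _ | _] = set0) ?closure0//.
by apply/seteqP; split=> x //=; rewrite eqxx.
Qed.

Lemma homeo_supportV f : homeo_support f^-1%g = homeo_support f.
Proof.
rewrite /homeo_support; congr closure; apply/seteqP; split => x /=;
  apply: contra_neq => e.
- by rewrite -{1}e homeo_funK.
- by rewrite -{1}e homeo_invK.
Qed.

Lemma homeo_supportM f g :
  homeo_support (f * g)%g `<=` homeo_support f `|` homeo_support g.
Proof.
rewrite /homeo_support -closureU; apply: closure_subset => x /=.
case: (eqVneq (g x) x) => [gx|_]; last by right.
by rewrite gx; left.
Qed.

End HomeoGroup.

Section Homeo0.
Context {R : realType} {M : topologicalType}.
Implicit Types f g : Homeo M.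

(* The values [F t] for [t] outside [0, 1] are irrelevant. *)
Definition isotopic_id f : Prop :=
  exists (F : R -> Homeo M) (C : set M),
    [/\ {within `[0, 1] `*` setT, continuous (fun p : R * M => F p.1 p.2)},
        F 0 = 1%g, F 1 = f,
        compact C &
        forall t, t \in `[0, 1] -> homeo_support (F t) `<=` C].

Definition homeo0 : {pred Homeo M} :=
  fun f => `[< compact (homeo_support f) /\ isotopic_id f >].

Lemma within_comp (X Y Z : topologicalType) (A : set X) (B : set Y)
    (f : Y -> Z) (g : X -> Y) :
  (forall x, A x -> B (g x)) ->
  {within B, continuous f} -> {within A, continuous g} ->
  {within A, continuous (f \o g)}.
Proof.
move=> AB /subspace_continuousP cf /subspace_continuousP cg.
apply/subspace_continuousP => x Ax.
apply: cvg_trans (cf _ (AB _ Ax)).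
move=> P /= /(cg _ Ax); rewrite /nbhs /= /within /= => h.
by near=> y => Ay; apply: (near h y _ Ay (AB _ Ay)).
Unshelve. all: by end_near. Qed.

Lemma within_pair (X Y Z : topologicalType) (A : set X)
    (f : X -> Y) (g : X -> Z) :
  {within A, continuous f} -> {within A, continuous g} ->
  {within A, continuous (fun x => (f x, g x))}.
Proof. by move=> cf cg x; apply: cvg_pair; [exact: cf|exact: cg]. Qed.

Lemma isotopic_id1 : isotopic_id 1%g.
Proof.
exists (fun=> 1%g), set0; split => //.
- by apply: continuous_subspaceT => p; exact: cvg_snd.
- exact: compact0.
- by move=> t _; rewrite homeo_support1.
Qed.

Lemma isotopic_idM f g :
  isotopic_id f -> isotopic_id g -> isotopic_id (f * g)%g.
Proof.
move=> [F [C [cF F0 F1 cC FC]]] [G [D [cG G0 G1 cD GD]]].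
exists (fun t => F t * G t)%g, (C `|` D); split.
- pose H (p : R * M) := (p.1, G p.1 p.2).
  have cH : {within `[0, 1] `*` setT, continuous H}.
    apply: within_pair => //.
    by apply: continuous_subspaceT => p; exact: cvg_fst.
  have HH p : (`[0, 1] `*` setT) p -> (`[0, 1] `*` setT) (H p) by move=> [].
  exact: (within_comp HH cF cH).
- by rewrite F0 G0 mulg1.
- by rewrite F1 G1.
- exact: compactU.
- move=> t t01; apply: subset_trans (@homeo_supportM _ _ _) _.
  by apply: setUSS; [exact: FC|exact: GD].
Qed.

Lemma isotopic_idV f : isotopic_id f -> isotopic_id f^-1%g.
Proof.
move=> [F [C [cF F0 F1 cC FC]]].
have t01 (t : R) : t \in `[0, 1] -> 1 - t \in `[0, 1].
  by rewrite !in_itv/= subr_ge0 gerBl => /andP[-> ->].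
have f1 : homeo_support f `<=` C.
  by rewrite -F1; apply: FC; rewrite in_itv/= ler01 lexx.
exists (fun t => f^-1 * F (1 - t))%g, C; split => //.
- pose H (p : R * M) := (1 - p.1, p.2).
  have cH : {within `[0, 1] `*` setT, continuous H}.
    apply: within_pair; apply: continuous_subspaceT => p; last exact: cvg_snd.
    by apply: cvgB; [exact: cvg_cst|exact: cvg_fst].
  have HH p : (`[0, 1] `*` setT) p -> (`[0, 1] `*` setT) (H p).
    by move=> [/= /t01].
  have cV : {within setT, continuous (f^-1)%g}.
    by apply: continuous_subspaceT; exact: homeo_continuous.
  exact: (within_comp (fun _ _ => I) cV (within_comp HH cF cH)).
- by rewrite subr0 F1 mulVg.
- by rewrite subrr F0 mulg1.
- move=> t /t01 /FC tC; apply: subset_trans (@homeo_supportM _ _ _) _.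
  by rewrite homeo_supportV => x [/f1|/tC].
Qed.

Lemma homeo0_group_closed : group_closed homeo0.
Proof.
split.
  apply/asboolP; split; last exact: isotopic_id1.
  by rewrite homeo_support1; exact: compact0.
move=> f g /asboolP[cf hf] /asboolP[cg hg]; apply/asboolP; split.
  apply: (subclosed_compact _ (compactU cf cg)); first exact: closed_closure.
  by rewrite -(homeo_supportV g); exact: homeo_supportM.
by apply: isotopic_idM => //; exact: isotopic_idV.
Qed.

End Homeo0.

(* [R] only provides the time parameter of the isotopies of [M]. *)
Record Homeo0 (R : realType) (M : topologicalType) := Homeo0Pack {
  homeo0_val :> Homeo M;
  homeo0_valP : homeo0_val \in @homeo0 R M
}.

HB.instance Definition _ (R : realType) (M : topologicalType) :=
  [isSub for @homeo0_val R M].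
HB.instance Definition _ (R : realType) (M : topologicalType) :=
  [Choice of Homeo0 R M by <:].
HB.instance Definition _ (R : realType) (M : topologicalType) :=
  SubChoice_isSubGroup.Build (Homeo M) _ (Homeo0 R M)
    (@homeo0_group_closed R M).

Definition manifold1 (R : realType) (N : topologicalType) : Prop :=
  [/\ hausdorff_space N, @second_countable N &
      forall x : N, exists (U : set N) (V : set R),
        [/\ open U, U x, open V & inhabited (homeo U V)]].

Definition is_component (T : topologicalType) (A I : set T) : Prop :=
  exists2 x, A x & I = connected_component A x.

(* Main.v *)
(* Elements of [Homeo0 R R] are the increasing bijections of [R] with bounded
   support; write [Gamma l r] for the group of those with compact support in
   [ ]l, r[ ], given by the predicate [supported l r].

   Automatic continuity.  [Gamma l r] contains all infinite products of elements
   supported in disjoint intervals accumulating inside [ ]l, r[ ], and each of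
   its elements is a commutator.  By a diagonal argument, if countably many sets
   [T_k] cover [Gamma l r], then on some subinterval every element of
   [Gamma l' r'] is a commutator of an element of [T_k^-1 T_k] and one of
   [T_k'^-1 T_k'].  Hence [Gamma l r] has no proper subgroup of countable index
   (so it cannot move the countably many components of an invariant open subset of
   [N], nor their boundary points, which are isolated in the boundary), and for
   every point [p] and every neighbourhood [V] of [p] some [Gamma l' r'] sends [p]
   into [V].

   It follows that a point [p] cannot be moved by two commuting groups
   [Gamma l1 r1], [Gamma l2 r2] on disjoint intervals.  So a point [p] moved by
   the action has a centre [a], characterised by: [p] is fixed by the elements
   supported in [ ]-oo, a[ ] and by those supported in [ ]a, +oo[ ].  The map
   [centre] is continuous and equivariant; it has no local extremum, since by
   equivariance every real would be an extremal value.  It is therefore a local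
   homeomorphism, the stabilizer of [a] fixes [p], and [g a |-> g p] is a
   homeomorphism from [R] onto the component of [p]. *)
Require Import Defs.
From HB Require Import structures.
From mathcomp Require Import all_boot all_order all_algebra.
From mathcomp Require Import all_classical all_reals all_analysis.
From mathcomp Require Import lra.
Import numFieldNormedType.Exports.
Set Implicit Arguments.
Unset Strict Implicit.
Unset Printing Implicit Defensive.
Import Order.TTheory GRing.Theory Num.Theory.
Local Open Scope classical_set_scope.
Local Open Scope ring_scope.

(** * Increasing bijections of the line *)

Section Line.
Variable R : realType.
Implicit Types (l r a b c d e x y : R).
Local Notation G := (Homeo0 R R).

Lemma homeo0_ext (f g : G) : (forall x, f x = g x) -> f = g.
Proof. by move=> fg; apply: val_inj; apply: homeo_eqP. Qed.

Lemma homeo0M (f g : G) x : (f * g)%g x = f (g x).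
Proof. by []. Qed.

Lemma homeo01 x : (1%g : G) x = x.
Proof. by []. Qed.

Lemma homeo0K (f : G) x : (f^-1)%g (f x) = x.
Proof. by rewrite -homeo0M mulVg. Qed.

Lemma homeo0VK (f : G) x : f ((f^-1)%g x) = x.
Proof. by rewrite -homeo0M mulgV. Qed.

Lemma homeo0_bounded (f : G) :
  exists a b, a < b /\ forall x, x <= a \/ b <= x -> f x = x.
Proof.
have /asboolP[cf _] := homeo0_valP f.
have [M [Mr HM]] := compact_bounded cf.
pose B := `|M| + 1.
have MB : M < B by rewrite /B (le_lt_trans (ler_norm M)) ?ltrDl.
have B0 : 0 < B by rewrite /B ltr_pwDr.
exists (- (B + 1)), (B + 1); split; first lra.
move=> x xB; apply: contrapT => /eqP fx.
have := HM _ MB x; rewrite /homeo_support => /(_ (@subset_closure _ [set z | f z !=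
  z] x fx)).
rewrite /= ler_norml => /andP[]; lra.
Qed.

(** A continuous injection of the line is monotone, and the fixed points [b] and [b + 1] exclude the
    decreasing case. *)
Lemma homeo0_mono (f : G) x y : x < y -> f x < f y.
Proof.
move=> xy.
have cf : {within [set` `]-oo, +oo[%R], continuous f}.
  by apply: continuous_subspaceT => z; apply: homeo_continuous.
have injf : {in `]-oo, +oo[ &, injective f}.
  by move=> u v _ _ uv; rewrite -(homeo0K f u) uv homeo0K.
have [a [b [ab fid]]] := homeo0_bounded f.
have [] := itv_continuous_inj_mono cf injf.
  by move=> H; apply: H; rewrite ?in_itv.
move=> /(_ (b + 1) b); rewrite !in_itv /=.
by rewrite (fid b) ?(fid (b + 1)); [move=> /(_ isT isT); lra|right; lra..].
Qed.

Lemma homeo0_le (f : G) x y : (f x <= f y) = (x <= y).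
Proof.
by apply: (le_mono (f := f)) => u v; exact: homeo0_mono.
Qed.

Lemma homeo0_lt (f : G) x y : (f x < f y) = (x < y).
Proof. by rewrite !ltNge homeo0_le. Qed.

Lemma homeo0_leVl (f : G) x y : (f^-1%g x <= y) = (x <= f y).
Proof. by rewrite -(homeo0_le f) homeo0VK. Qed.

Lemma homeo0_leVr (f : G) x y : (x <= f^-1%g y) = (f x <= y).
Proof. by rewrite -(homeo0_le f) homeo0VK. Qed.

Lemma homeo0_ltVl (f : G) x y : (f^-1%g x < y) = (x < f y).
Proof. by rewrite -(homeo0_lt f) homeo0VK. Qed.

Lemma homeo0_ltVr (f : G) x y : (x < f^-1%g y) = (f x < y).
Proof. by rewrite -(homeo0_lt f) homeo0VK. Qed.

(** Surjectivity leaves no room for jumps: the preimages [u], [v] of [f x - e], [f x + e] bound a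
    suitable neighbourhood of [x]. *)
Lemma increasing_continuous (f : R -> R) :
  {homo f : x y / x < y} -> (forall y, exists x, f x = y) -> continuous f.
Proof.
move=> fi fs x; apply/cvgrPdist_lt => e e0.
have lef := le_mono fi; have ltf := leW_mono lef.
have [u fu] := fs (f x - e); have [v fv] := fs (f x + e).
have ux : u < x by rewrite -(ltf u) fu; lra.
have xv : x < v by rewrite -(ltf x) fv; lra.
near=> y.
have uy : u < y by near: y; apply: lt_nbhsr.
have yv : y < v by near: y; apply: lt_nbhsl.
move: uy yv; rewrite -(ltf u) fu -(ltf y) fv => ? ?.
rewrite ltr_norml; apply/andP; split; lra.
Unshelve. all: by end_near. Qed.

Lemma increasing_homeo (f : R -> R) :
  {homo f : x y / x < y} -> (forall y, exists x, f x = y) ->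
  exists h : Homeo R, forall x, h x = f x.
Proof.
move=> fi fs; have [g fK] := choice fs.
have gf : cancel f g.
  by move=> x; apply: (inc_inj (le_mono fi)); rewrite fK.
have gi : {homo g : x y / x < y}.
  by move=> x y; rewrite -{1}(fK x) -{1}(fK y) (leW_mono (le_mono fi)).
have gs y : exists x, g x = y by exists (f y).
by exists (HomeoPack (increasing_continuous fi fs) (increasing_continuous gi gs) gf fK).
Qed.
End Line.

(** * Construction of compactly supported homeomorphisms of the line *)

Section Constructions.
Variable R : realType.
Implicit Types (l r a b c d e x y : R).
Local Notation G := (Homeo0 R R).

(** The straight-line isotopy [F t] joins the identity to [f]: convex combinations of increasing
    maps are increasing, and what [f] fixes stays fixed. *)
Lemma increasing_homeo0 (f : R -> R) c d :
  {homo f : x y / x < y} -> (forall y, exists x, f x = y) ->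
  (forall x, x <= c \/ d <= x -> f x = x) ->
  exists h : G, forall x, h x = f x.
Proof.
move=> fi fs fid; have fc := increasing_continuous fi fs.
pose F t x : R := x + t * (f x - x).
have F0 x : F 0 x = x by rewrite /F mul0r addr0.
have F1 x : F 1 x = f x by rewrite /F mul1r addrC subrK.
have Fid t x : x <= c \/ d <= x -> F t x = x.
  by move=> /fid; rewrite /F => ->; rewrite subrr mulr0 addr0.
have Fc : continuous (fun p : R * R => F p.1 p.2).
  move=> p; apply: cvgD; first exact: cvg_snd.
  apply: cvgM; first exact: cvg_fst.
  apply: cvgB; last exact: cvg_snd.
  by apply: continuous_comp; [exact: cvg_snd|exact: fc].
have Ftc t : continuous (F t).
  move=> x; apply: cvgD; first exact: cvg_id.
  apply: cvgM; first exact: cvg_cst.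
  by apply: cvgB; [exact: fc|exact: cvg_id].
have Fi t : t \in `[0, 1] -> {homo F t : x y / x < y}.
  rewrite in_itv /= => /andP[t0 t1] x y xy; have fxy := fi _ _ xy.
  rewrite /F; have [->|tn1] := eqVneq t 1; first lra.
  have {}t1 : t < 1 by rewrite lt_neqAle tn1.
  have : 0 < (1 - t) * (y - x) by apply: mulr_gt0; lra.
  have : 0 <= t * (f y - f x) by apply: mulr_ge0; lra.
  rewrite !mulrBl !mulrBr; lra.
have Fs t : forall y, exists x, F t x = y.
  move=> y; have [yc|cy] := leP y c; first by exists y; rewrite Fid //; left.
  have [dy|yd] := leP d y; first by exists y; rewrite Fid //; right.
  have cd : c <= d by lra.
  have [||x _ <-] := @IVT R (F t) c d y cd; last by exists x.
    exact: continuous_subspaceT.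
  rewrite (Fid t c) ?(Fid t d); [|by right|by left].
  by rewrite minEle maxEle cd; apply/andP; split; lra.
(* Outside [[0, 1]] the map [F t] may fail to be injective, so nothing is required of [H t]
   there. *)
have exH t : exists h : Homeo R, t \in `[0, 1] -> forall x, h x = F t x.
  have [t01|_] := boolP (t \in `[0, 1]); last by exists 1%g.
  by have [h hE] := increasing_homeo (Fi _ t01) (Fs t); exists h.
have [H HE] := choice exH.
have H1E x : H 1 x = f x by rewrite HE ?F1 // in_itv /= ler01 lexx.
have Hsupp t : t \in `[0, 1] -> homeo_support (H t) `<=` `[c, d].
  move=> t01; rewrite [X in _ `<=` X](closure_id _).1; last exact: itv_closed.
  apply: closure_subset => x /=; rewrite in_itv /= HE // => Hx.
  by apply/andP; split; rewrite leNgt; apply: contraNN Hx => /ltW ?;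
    rewrite Fid //; [left|right].
have h0 : H 1 \in @homeo0 R R.
  apply/asboolP; split.
    apply: (subclosed_compact _ (@segment_compact _ c d)).
      exact: closed_closure.
    by apply: Hsupp; rewrite in_itv /= ler01 lexx.
  exists H, (`[c, d]%classic); split => //.
  - apply: (@subspace_eq_continuous _ _ _ (fun p : R * R => F p.1 p.2)).
      by move=> [t x] /set_mem [/= t01 _]; rewrite /from_subspace /= HE.
    exact: continuous_subspaceT.
  - by apply: homeo_eqP => x; rewrite HE ?F0 // in_itv /= ler01 lexx.
  - exact: segment_compact.
by exists (Homeo0Pack h0).
Qed.

(** The inner bounds [c], [d] keep the support compact inside []l, r[]. The case [d <= c] is allowed
    and forces [f] to be the identity. *)
Definition supported l r (f : G) : Prop :=
  exists c d, [/\ l < c, d < r & forall x, x <= c \/ d <= x -> f x = x].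

Lemma supported_id l r f x : supported l r f -> x <= l \/ r <= x -> f x = x.
Proof. by move=> [c [d [lc dr fid]]] xlr; apply: fid; lra. Qed.

Lemma supported_ends l r f : supported l r f -> f l = l /\ f r = r.
Proof. by move=> sf; split; apply: supported_id sf _; [left|right]. Qed.

Lemma stable_segment l r (f : G) x :
  f l = l -> f r = r -> (l <= f x <= r) = (l <= x <= r).
Proof. by move=> fl fr; rewrite -{1}fl -{1}fr !homeo0_le. Qed.

Lemma supported_sub l r l' r' f :
  l <= l' -> r' <= r -> supported l' r' f -> supported l r f.
Proof. by move=> ll rr [c [d [lc dr fid]]]; exists c, d; split => //; lra. Qed.

Lemma supported1 l r : supported l r 1%g.
Proof. by exists (l + 1), (r - 1); split => //; lra. Qed.

Lemma supportedM l r (f g : G) :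
  supported l r f -> supported l r g -> supported l r (f * g)%g.
Proof.
move=> [c [d [lc dr fid]]] [c' [d' [lc' dr' gid]]].
exists (Num.min c c'), (Num.max d d'); split.
- by rewrite lt_min lc lc'.
- by rewrite gt_max dr dr'.
- move=> x; rewrite le_min ge_max => H.
  by rewrite homeo0M gid ?fid //; case: H => /andP[]; lra.
Qed.

Lemma supportedV l r f : supported l r f -> supported l r (f^-1)%g.
Proof.
move=> [c [d [lc dr fid]]]; exists c, d; split => // x xcd.
by rewrite -{1}(fid x xcd) homeo0K.
Qed.

Lemma supportedJ l r (f g : G) : supported l r f
  -> supported (g l) (g r) (g * f * g^-1)%g.
Proof.
move=> [c [d [lc dr fid]]]; exists (g c), (g d); rewrite !homeo0_lt.
split => // x xcd; rewrite !homeo0M fid ?homeo0VK //.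
by rewrite -(homeo0_le g) -(homeo0_le g d) homeo0VK.
Qed.

Lemma supported_commute l r l' r' (f g : G) :
  r <= l' -> supported l r f -> supported l' r' g -> (f * g = g * f)%g.
Proof.
move=> rl sf sg; apply: homeo0_ext => x; rewrite !homeo0M.
have [xl|lx] := leP x l'.
  rewrite (supported_id sg (or_introl xl)) (supported_id sg) //; left.
  rewrite leNgt; apply/negP => fx; have xr : x < r.
    rewrite ltNge; apply/negP => rx.
    by move: fx; rewrite (supported_id sf (or_intror rx)); lra.
  by move: xr; rewrite -(homeo0_lt f) (supported_id sf (or_intror (lexx r))); lra.
rewrite (supported_id sf (or_intror _)); last first.
  have: g l' < g x by rewrite homeo0_lt.
  by rewrite (supported_id sg (or_introl (lexx _))); lra.
by rewrite (supported_id sf (or_intror _)) //; lra.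
Qed.

Lemma homeo0_supported (f : G) : exists l r, l < r /\ supported l r f.
Proof.
have [a [b [ab fid]]] := homeo0_bounded f.
by exists (a - 1), (b + 1); split; [lra|exists a, b; split => //; lra].
Qed.

(* The graph is the upper envelope of the diagonal and the lower envelope of the
   lines through [(l, l)], [(a, b)] and through [(a, b)], [(r, r)]. *)
Lemma push_up l a b r : l < a -> a < b -> b < r ->
  exists g : G, g a = b /\ forall x, x <= l \/ r <= x -> g x = x.
Proof.
move=> la ab br; pose s := (b - l) / (a - l); pose t := (r - b) / (r - a).
have s1 : 1 < s by rewrite /s ltr_pdivlMr; lra.
have t0 : 0 < t by rewrite /t; apply: divr_gt0; lra.
have t1 : t < 1 by rewrite /t ltr_pdivrMr; lra.
pose u x := l + s * (x - l); pose v x := r - t * (r - x).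
pose f x := Num.max x (Num.min (u x) (v x)).
have ui : {homo u : x y / x < y}.
  by move=> x y xy; rewrite /u ltrD2l ltr_pM2l; lra.
have vi : {homo v : x y / x < y}.
  by move=> x y xy; rewrite /v ltrD2l ltrN2 ltr_pM2l; lra.
have fi : {homo f : x y / x < y}.
  move=> x y xy; have ux := ui _ _ xy; have vx := vi _ _ xy.
  rewrite /f gt_max !lt_max xy /=; apply/orP; right.
  by rewrite lt_min !gt_min ux vx orbT.
have fid x : x <= l \/ r <= x -> f x = x.
  move=> xlr; apply/max_idPl; rewrite ge_min; apply/orP.
  case: xlr => xlr; [left|right]; rewrite /u /v.
    have : s * (x - l) <= 1 * (x - l) by apply: ler_wnM2r; lra.
    lra.
  have : 1 * (r - x) <= t * (r - x) by apply: ler_wnM2r; lra.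
  lra.
have uc : continuous u.
  move=> x; apply: cvgD; first exact: cvg_cst.
  by apply: cvgM; [exact: cvg_cst|apply: cvgB; [exact: cvg_id|exact: cvg_cst]].
have vc : continuous v.
  move=> x; apply: cvgB; first exact: cvg_cst.
  by apply: cvgM; [exact: cvg_cst|apply: cvgB; [exact: cvg_cst|exact: cvg_id]].
have fc : continuous f.
  move=> x; have idc : {for x, continuous (@idfun R)} by exact: cvg_id.
  exact: (continuous_max idc (continuous_min (uc x) (vc x))).
have fs y : exists x, f x = y.
  have [yl|ly] := leP y l; first by exists y; rewrite fid //; left.
  have [ry|yr] := leP r y; first by exists y; rewrite fid //; right.
  have lr : l <= r by lra.
  have [||x _ <-] := @IVT R f l r y lr; last by exists x.
    exact: continuous_subspaceT.
  rewrite (fid l) ?(fid r); [|by right|by left].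
  by rewrite minEle maxEle lr; apply/andP; split; lra.
have [g gE] := increasing_homeo0 fi fs fid.
exists g; split; last by move=> x xlr; rewrite gE fid.
rewrite gE /f /u /v /s /t !divfK ?subr_eq0 ?(gt_eqF la) ?gt_eqF ?(lt_trans ab) //.
by rewrite subKr addrC subrK minxx; apply/max_idPr; exact: ltW.
Qed.

Lemma push l r a b : l < a -> a < r -> l < b -> b < r ->
  exists g : G, supported l r g /\ g a = b.
Proof.
wlog ab : a b / a < b => [H la ar lb br|la _ _ br].
  have [ab|ba|<-] := ltgtP a b; first exact: H.
    have [g [sg gb]] := H b a ba lb br la ar.
    by exists g^-1%g; split; [exact: supportedV|rewrite -gb homeo0K].
  by exists 1%g; split => //; exact: supported1.
(* Midpoints leave the margins at [l] and [r] that [supported] demands. *)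
have [||g [gab gid]] := @push_up ((l + a) / 2) a b ((b + r) / 2) _ ab; [lra..|].
by exists g; split => //; exists ((l + a) / 2), ((b + r) / 2); split => //; lra.
Qed.

(** [g] preserves both half-lines at its fixed point [m], so its graph can be cut there. *)
Lemma split_at (g : G) m : g m = m ->
  exists u v : G, [/\ g = (u * v)%g,
    forall x, u x = if x <= m then g x else x &
    forall x, v x = if x <= m then x else g x].
Proof.
move=> gm; have [a [b [ab gid]]] := homeo0_bounded g.
have gle x : (g x <= m) = (x <= m) by rewrite -{1}gm homeo0_le.
have glt x : (g x < m) = (x < m) by rewrite -{1}gm homeo0_lt.
pose f x := if x <= m then g x else x.
pose h x := if x <= m then x else g x.
have [|||u uE] := @increasing_homeo0 f (Num.min a m) (Num.max b m).
- move=> x y xy; rewrite /f; case: (leP x m) => xm; case: (leP y m) => ym //; try lra.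
    by rewrite homeo0_lt.
  by apply: le_lt_trans ym; rewrite gle.
- move=> y; have [ym|my] := leP y m.
    by exists (g^-1 y)%g; rewrite /f -gle homeo0VK ym.
  by exists y; rewrite /f leNgt my.
- move=> x; rewrite le_min ge_max /f => -[|] /andP[xa xm].
    by rewrite gid ?if_same //; left.
  by rewrite gid ?if_same //; right.
have [|||v vE] := @increasing_homeo0 h (Num.min a m) (Num.max b m).
- move=> x y xy; rewrite /h; case: (leP x m) => xm; case: (leP y m) => ym //; try lra.
    by apply: le_lt_trans xm _; rewrite ltNge gle -ltNge.
  by rewrite homeo0_lt.
- move=> y; have [ym|my] := leP y m; first by exists y; rewrite /h ym.
  by exists (g^-1 y)%g; rewrite /h -gle homeo0VK leNgt my.
- move=> x; rewrite le_min ge_max /h => -[|] /andP[xa xm].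
    by rewrite gid ?if_same //; left.
  by rewrite gid ?if_same //; right.
exists u, v; split => //; apply: homeo0_ext => x.
rewrite homeo0M uE vE /f /h; case: (leP x m) => xm; first by rewrite xm.
by rewrite gle leNgt xm.
Qed.

Lemma seq_increasing (c : nat -> R) : (forall n, c n < c n.+1) ->
  {homo c : m n / (m <= n)%N >-> m <= n}.
Proof. by move=> ci; apply/nondecreasing_seqP => n; exact/ltW. Qed.

(** The [f n] are glued along the successive cells [[c n, c n.+1[]. Where the cells accumulate,
    continuity comes from [F] being an increasing surjection. *)
Lemma infinite_product (c : nat -> R) (f : nat -> G) l r :
  (forall n, c n < c n.+1) -> (forall n, l <= c n <= r) ->
  (forall n x, x <= c n \/ c n.+1 <= x -> f n x = x) ->
  exists F : G, (forall n x, c n <= x <= c n.+1 -> F x = f n x) /\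
    (forall x, (forall n, ~ (c n <= x < c n.+1)) -> F x = x).
Proof.
move=> ci cb fid; have cm := seq_increasing ci.
have fic n x : c n <= x < c n.+1 -> c n <= f n x < c n.+1.
  have fn : f n (c n) = c n by apply: fid; left.
  have fn1 : f n (c n.+1) = c n.+1 by apply: fid; right.
  by rewrite -(homeo0_le (f n)) -(homeo0_lt (f n)) fn fn1.
have cinj m n x : c n <= x < c n.+1 -> c m <= x < c m.+1 -> m = n.
  move=> /andP[nx xn] /andP[mx xm]; apply/eqP; rewrite eqn_leq.
  by apply/andP; split; rewrite leqNgt; apply/negP => /cm; lra.
have step g : (forall n x, c n <= x < c n.+1 -> c n <= g n x < c n.+1) ->
    exists F : R -> R, (forall n x, c n <= x < c n.+1 -> F x = g n x) /\
    (forall x, (forall n, ~ (c n <= x < c n.+1)) -> F x = x).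
  move=> gc.
  have ex x : exists y : R, (forall n, c n <= x < c n.+1 -> y = g n x) /\
    ((forall n, ~ (c n <= x < c n.+1)) -> y = x).
    have [[n xn]|H] := pselect (exists n, c n <= x < c n.+1).
      exists (g n x); split; last by move=> /(_ n).
      by move=> m xm; rewrite (cinj _ _ _ xm xn).
    by exists x; split => // n xn; case: H; exists n.
  have [F FE] := choice ex.
  by exists F; split => [n x /(proj1 (FE x))|x /(proj2 (FE x))].
have [F [FE Fid]] := step _ fic.
have FC x n : c n <= x -> c n <= F x.
  move=> nx; have [[m xm]|/forallNP H] := pselect (exists n, c n <= x < c n.+1).
    rewrite (FE _ _ xm); have /andP[? _] := fic _ _ xm.
    have nm : (n <= m)%N.
      by rewrite leqNgt; apply/negP => /cm; move: xm => /andP[]; lra.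
    by apply: le_trans (cm _ _ nm) _.
  by rewrite Fid.
have Fi : {homo F : x y / x < y}.
  move=> x y xy; have [[m xm]|/forallNP H] := pselect (exists n, c n <= x < c n.+1).
    rewrite (FE _ _ xm); have [ym|my] := ltP y (c m.+1).
      rewrite (FE m) ?homeo0_lt //; move: xm => /andP[]; lra.
    by apply: lt_le_trans (FC _ _ my); have /andP[] := fic _ _ xm.
  rewrite (Fid x) //.
  have [[m ym]|/forallNP H'] := pselect (exists n, c n <= y < c n.+1); last
    by rewrite Fid.
  rewrite (FE _ _ ym); have /andP[+ _] := fic _ _ ym; apply: lt_le_trans.
  rewrite ltNge; apply/negP => mx; apply: (H m).
  by rewrite mx (lt_trans xy) //; case/andP: ym.
have Fs y : exists x, F x = y.
  have [[m ym]|/forallNP H'] := pselect (exists n, c n <= y < c n.+1); last first.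
    by exists y; rewrite Fid.
  have yv : c m <= (f m)^-1%g y < c m.+1.
    by rewrite -(homeo0_le (f m)) -(homeo0_lt (f m)) homeo0VK !fid; [|right|left].
  by exists ((f m)^-1%g y); rewrite (FE m) ?homeo0VK.
have Fb x : x <= l \/ r <= x -> F x = x.
  move=> xlr; have [[m xm]|/forallNP H] := pselect (exists n, c n <= x < c n.+1);
    last by rewrite Fid.
  rewrite (FE _ _ xm) fid //; have := cb m; have := cb m.+1; move: xm; lra.
have [h hE] := increasing_homeo0 Fi Fs Fb.
exists h; split => [n x|x xN]; rewrite hE; last exact: Fid.
(* The right end of a half-open cell belongs to the next cell; both factors fix it. *)
move=> /andP[nx]; rewrite le_eqVlt => /predU1P[->|xn]; last by rewrite (FE n) ?nx.
by rewrite (FE n.+1) ?lexx ?ci // !fid //; [right|left].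
Qed.
End Constructions.

(** * Commutators and subgroups of countable index *)

Section Algebra.
Variable R : realType.
Implicit Types (l r a b c d e x y : R).
Local Notation G := (Homeo0 R R).

(* If the translates [h^n [c, d[] are disjoint, then the product [F] of the
   [h^n f h^-n] satisfies [F = f (h F h^-1)]. *)
Lemma supported_commutator l r (f : G) : supported l r f ->
  exists u v : G, [/\ supported l r u, supported l r v &
    f = (u * v * u^-1 * v^-1)%g].
Proof.
move=> [c [d [lc dr fid]]]; have [dc|cd] := leP d c.
  exists 1%g, 1%g; split; [exact: supported1..|].
  apply: homeo0_ext => x; rewrite !mul1g invg1 fid // ?mul1g //.
  by have [xc|/ltW cx] := leP x c; [left|right; exact: le_trans cx].
have [||h [hc hid]] := @push_up R ((l + c) / 2) c d ((d + r) / 2) _ cd; [lra..|].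
set l0 := (l + c) / 2 in hid; set r0 := (d + r) / 2 in hid.
have hnid n x : x <= l0 \/ r0 <= x -> (h ^+ n)%g x = x.
  by move=> xlr; elim: n => [//|n IH]; rewrite expgS homeo0M IH hid.
pose c_ n := (h ^+ n)%g c.
have c_S n : c_ n.+1 = h (c_ n) by rewrite /c_ expgS homeo0M.
have c_Sd n : c_ n.+1 = (h ^+ n)%g d by rewrite /c_ expgSr homeo0M hc.
have ci n : c_ n < c_ n.+1 by rewrite c_Sd /c_ homeo0_lt.
have cb n : l0 <= c_ n <= r0.
  have hl : (h ^+ n)%g l0 = l0 by apply: hnid; left.
  have hr : (h ^+ n)%g r0 = r0 by apply: hnid; right.
  by rewrite -{1}hl -{1}hr !homeo0_le /l0 /r0; apply/andP; split; lra.
pose f_ n := (h ^+ n * f * (h ^+ n)^-1)%g.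
have f_id n x : x <= c_ n \/ c_ n.+1 <= x -> f_ n x = x.
  move=> xc; rewrite /f_ !homeo0M fid ?homeo0VK //.
  by rewrite homeo0_leVl homeo0_leVr -c_Sd.
have f_S n x : f_ n.+1 x = h (f_ n (h^-1 x)%g).
  by rewrite /f_ expgS !invgM !homeo0M.
have [F [FE Fid]] := infinite_product ci cb f_id.
have hV n x : (c_ n <= h^-1%g x < c_ n.+1) = (c_ n.+1 <= x < c_ n.+2).
  by rewrite -(homeo0_le h) -(homeo0_lt h) homeo0VK -!c_S.
have c0 : c_ 0%N = c by [].
have c1 : c_ 1%N = d by rewrite c_Sd.
have cm := seq_increasing ci.
have FE' n x : c_ n <= x < c_ n.+1 -> F x = f_ n x.
  by move=> /andP[? /ltW ?]; apply: FE; apply/andP.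
have key : F = (f * (h * F * h^-1))%g.
  apply: homeo0_ext => x; rewrite !homeo0M.
  have [[[|n] xn]|/forallNP xN] := pselect (exists n, c_ n <= x < c_ n.+1).
  - rewrite (FE' _ _ xn) (Fid (h^-1%g x)) ?homeo0VK; last first.
      by move=> n; rewrite hV => /andP[nx _]; move: xn (cm 1%N n.+1 isT) => /andP[];
        lra.
    by rewrite /f_ expg0 mul1g invg1 mulg1.
  - rewrite (FE' _ _ xn) (FE' n) ?hV // -f_S [RHS]fid //; right.
    rewrite -c1; apply: le_trans (cm 1%N n.+1 isT) _.
    rewrite -(f_id n.+1 (c_ n.+1)); last by left.
    by rewrite homeo0_le; case/andP: xn.
  - rewrite Fid // Fid ?homeo0VK; last by move=> n; rewrite hV; exact: xN.
    rewrite fid //; have := xN 0%N; rewrite c0 c1.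
    have [xc|cx] := leP x c; first by left.
    by have [dx|xd] := leP d x; [right|rewrite (ltW cx)].
have sh : supported l r h by exists l0, r0; split => //; rewrite /l0 /r0; lra.
have sF : supported l r F.
  have [ll0 r0r] : l < l0 /\ r0 < r by rewrite /l0 /r0; split; lra.
  exists ((l + l0) / 2), ((r0 + r) / 2); split; [lra..|move=> x xlr; apply: Fid => n].
  have /andP[? _] := cb n; have /andP[_ ?] := cb n.+1.
  by move=> /andP[? ?]; case: xlr; lra.
exists F, h; split => //.
(* Solving [F = f (h F h^-1)] for [f] gives the commutator of [F] and [h]. *)
apply: (mulIg (h * F * h^-1)%g); rewrite -key.
by rewrite !mulgA !(mulgVK, mulgK).
Qed.

(** Diagonal argument: otherwise each [T k] misses some [u k] on the [k]-th of a sequence of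
    disjoint cells. The product of all [u k] lies in some [T k] and yet agrees with [u k] on that
    cell. *)
Lemma diagonal_cover l r (T : nat -> G -> Prop) : l < r ->
  (forall f, supported l r f -> exists k, T k f) ->
  exists l' r' k, [/\ l < l', l' < r', r' < r &
    forall u, supported l' r' u -> exists a : G, [/\ supported l r a, T k a &
      forall x, l' <= x <= r' -> a x = u x]].
Proof.
move=> lr cov; apply: contrapT => nH.
pose l0 := (2 * l + r) / 3; pose r0 := (l + 2 * r) / 3.
have l0r0 : 0 < r0 - l0 by rewrite /l0 /r0; lra.
pose c n : R := r0 - (r0 - l0) / n.+1%:R.
have ci n : c n < c n.+1.
  by rewrite /c ltrD2l ltrN2 ltr_pM2l // ltf_pV2 ?posrE // ltr_nat.
have cb n : l0 <= c n <= r0.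
  rewrite /c lerBrDr -lerBrDl ler_pdivrMr // gerBl divr_ge0 ?(ltW l0r0) // andbT.
  by rewrite -[leLHS]mulr1 ler_pM2l // ler1n.
have [ll0 r0r] : l < l0 /\ r0 < r by rewrite /l0 /r0; split; lra.
have ex k : exists u, supported (c k) (c k.+1) u /\
    forall a : G, supported l r a -> T k a ->
      ~ (forall x, c k <= x <= c k.+1 -> a x = u x).
  apply: contrapT => nu; apply: nH; exists (c k), (c k.+1), k; split => //.
  - by have /andP[? _] := cb k; lra.
  - by have /andP[_ ?] := cb k.+1; lra.
  - move=> u su; apply: contrapT => na; apply: nu; exists u; split => // a sa Ta au.
    by apply: na; exists a.
have [u uP] := choice ex.
have [|F [FE Fid]] := infinite_product (f := u) ci cb.
  by move=> n x xc; apply: supported_id xc; exact: (uP n).1.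
have sF : supported l r F.
  exists ((l + l0) / 2), ((r0 + r) / 2); split; [lra..|move=> x xlr; apply: Fid => n].
  have /andP[? _] := cb n; have /andP[_ ?] := cb n.+1.
  by move=> /andP[? ?]; case: xlr; lra.
have [k Tk] := cov F sF.
exact: (uP k).2 F sF Tk (FE k).
Qed.

(** [diagonal_cover] is used twice, the second time inside the first interval. Then [a] agrees with
    [u] wherever [b] can act, and off [[l2, r2]], where [b] is uncontrolled, [u] is the identity; so
    the commutator of [a] and [b] is that of [u] and [v]. *)
Lemma diagonal_commutator l r (T : nat -> G -> Prop) : l < r ->
  (forall f, supported l r f -> exists k, T k f) ->
  exists l' r' k k', [/\ l < l', l' < r', r' < r &
    forall g, supported l' r' g -> exists a1 a2 b1 b2 : G,
      [/\ T k a1, T k a2, T k' b1, T k' b2 &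
       [/\ supported l r a1, supported l r a2, supported l r b1, supported l r b2 &
       g = ((a1^-1 * a2) * (b1^-1 * b2) * (a1^-1 * a2)^-1 * (b1^-1 * b2)^-1)%g]]].
Proof.
move=> lr cov; have [l1 [r1 [k [ll1 lr1 r1r H1]]]] := diagonal_cover lr cov.
have [|l2 [r2 [k' [ll2 lr2 r2r H2]]]] := @diagonal_cover l1 r1 T lr1.
  by move=> f sf; apply: cov; apply: supported_sub sf; exact: ltW.
exists l2, r2, k, k'; split; [lra..|].
move=> g /supported_commutator[u [v [su sv ->]]].
have su1 : supported l1 r1 u by apply: supported_sub su; exact: ltW.
have sv1 : supported l1 r1 v by apply: supported_sub sv; exact: ltW.
(* On [[l1, r1]] the element [a1] matches the identity and [a2] matches [u], so [a1^-1 a2] matches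
   [u]. *)
have [a1 [sa1 Ta1 a1E]] := H1 _ (supported1 l1 r1).
have [a2 [sa2 Ta2 a2E]] := H1 _ su1.
have [b1 [sb1 Tb1 b1E]] := H2 _ (supported1 l2 r2).
have [b2 [sb2 Tb2 b2E]] := H2 _ sv.
exists a1, a2, b1, b2; split => //; split => //.
- by apply: supported_sub sb1; exact: ltW.
- by apply: supported_sub sb2; exact: ltW.
set a := (a1^-1 * a2)%g; set b := (b1^-1 * b2)%g.
have [[ul1 ur1] [vl vr]] := (supported_ends su1, supported_ends sv).
have [ul ur] := supported_ends su.
have a1l : a1 l1 = l1 by rewrite a1E ?lexx ?(ltW lr1).
have a1r : a1 r1 = r1 by rewrite a1E ?lexx ?(ltW lr1).
have b1l : b1 l2 = l2 by rewrite b1E ?lexx ?(ltW lr2).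
have b1r : b1 r2 = r2 by rewrite b1E ?lexx ?(ltW lr2).
have aE x : l1 <= x <= r1 -> a x = u x.
  move=> x1; rewrite /a homeo0M a2E // -{1}(homeo01 (u x)) -(a1E (u x)) ?homeo0K //.
  by rewrite stable_segment.
have bE x : l2 <= x <= r2 -> b x = v x.
  move=> x1; rewrite /b homeo0M b2E // -{1}(homeo01 (v x)) -(b1E (v x)) ?homeo0K //.
  by rewrite stable_segment.
have sb : supported l1 r1 b by apply: supportedM sb2; apply: supportedV.
have al : a l1 = l1 by rewrite aE ?lexx ?(ltW lr1).
have ar : a r1 = r1 by rewrite aE ?lexx ?(ltW lr1).
have bl : b l2 = l2 by rewrite bE ?lexx ?(ltW lr2).
have br : b r2 = r2 by rewrite bE ?lexx ?(ltW lr2).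
have outside l' r' x : ~~ (l' <= x <= r') -> x <= l' \/ r' <= x.
  by rewrite negb_and -!ltNge => /orP[/ltW|/ltW]; [left|right].
have fV (h : G) x : h x = x -> h^-1%g x = x by move=> {1}<-; rewrite homeo0K.
have aVE x : l1 <= x <= r1 -> a^-1%g x = u^-1%g x.
  move=> x1; apply: (inc_inj (homeo0_le a)); rewrite homeo0VK aE ?homeo0VK //.
  by rewrite stable_segment // fV.
have vout x : ~~ (l2 <= x <= r2) -> v x = x.
  by move=> /outside; exact: supported_id.
have uout x : ~~ (l2 <= x <= r2) -> u x = x.
  by move=> /outside; exact: supported_id.
have bout x : ~~ (l1 <= x <= r1) -> b x = x.
  by move=> /outside; exact: supported_id.
clearbody a b; apply: homeo0_ext => x; rewrite !homeo0M.
have [x2|x2] := boolP (l2 <= x <= r2); last first.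
  rewrite (fV v) ?(fV u) ?vout ?uout //.
  have [x1|x1] := boolP (l1 <= x <= r1); last first.
    by rewrite (fV b) bout // ?homeo0VK // stable_segment // fV.
  have [bl1 br1] := supported_ends sb.
  have bx : l1 <= b^-1%g x <= r1 by rewrite stable_segment // fV.
  have bo : ~~ (l2 <= b^-1%g x <= r2) by rewrite stable_segment // fV.
  by rewrite aVE // (fV u) ?uout // homeo0VK aE // uout.
have bVE : b^-1%g x = v^-1%g x.
  apply: (inc_inj (homeo0_le b)); rewrite homeo0VK bE ?homeo0VK //.
  by rewrite stable_segment // fV.
have lift y : l2 <= y <= r2 -> l1 <= y <= r1 by move=> /andP[? ?]; apply/andP; split;
  lra.
have vx : l2 <= v^-1%g x <= r2 by rewrite stable_segment // fV.
have uvx : l2 <= u^-1%g (v^-1%g x) <= r2 by rewrite stable_segment // fV.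
by rewrite bVE aVE ?lift // bE // aE // lift // stable_segment.
Qed.

(** * Fragmentation and subgroups of countable index *)

(** Take [m] in the overlap []c, d[]. One of the two intervals contains both [m] and [f m], which
    gives [w] in [H] bringing [f m] back to [m]; then [w f] is cut at [m] into one piece for each
    interval. *)
Lemma fragmentation l c d r (H : G -> Prop) (f : G) :
  l <= c -> c < d -> d <= r ->
  (forall g h, H g -> H h -> H (g * h)%g) -> (forall g, H g -> H g^-1%g) ->
  (forall g, supported l d g -> H g) -> (forall g, supported c r g -> H g) ->
  supported l r f -> H f.
Proof.
move=> lc cd dr HM HV Hl Hr sf; pose m := (c + d) / 2.
have lm : l < m by rewrite /m; lra.
have mr : m < r by rewrite /m; lra.
have lfm : l < f m by rewrite -(supported_id sf (or_introl (lexx l))) homeo0_lt.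
have fmr : f m < r by rewrite -(supported_id sf (or_intror (lexx r))) homeo0_lt.
have [w [Hw sw wm]] : exists w : G, [/\ H w, supported l r w & w (f m) = m].
  have [fd|df] := ltP (f m) d.
    have [||w [sw wm]] := @push R l d (f m) m lfm fd; rewrite /m; [lra..|].
    by exists w; split => //; [exact: Hl|exact: supported_sub sw].
  have [||||w [sw wm]] := @push R c r (f m) m; rewrite /m; [lra..|].
  by exists w; split => //; [exact: Hr|exact: supported_sub sw].
have [|u [v [wE uE vE]]] := @split_at R (w * f)%g m; first by rewrite homeo0M.
have [c' [d' [lc' dr' wfid]]] := supportedM sw sf.
have -> : f = (w^-1 * (u * v))%g by rewrite -wE mulKg.
apply: (HM); first exact: HV.
apply: HM; [apply: Hl; exists c', m|apply: Hr; exists m, d'].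
- split => //; first by rewrite /m; lra.
  move=> x; rewrite uE; have [xm|//] := leP x m; case=> [xc|mx]; first
    by rewrite wfid //; left.
  by have -> : x = m; [lra|rewrite homeo0M].
- split => //; first by rewrite /m; lra.
  move=> x; rewrite vE; have [//|mx] := leP x m; case=> [xm|dx]; first lra.
  by rewrite wfid //; right.
Qed.

(** Two pushes carry the ends of a segment containing the support to [i] and [j]; the second push is
    supported to the right of [i] and so keeps the first end in place. *)
Lemma squeeze l l' r' r (f : G) : l < l' -> l' < r' -> r' < r ->
  supported l r f ->
  exists k : G, supported l r k /\ supported l' r' (k * f * k^-1)%g.
Proof.
move=> ll lr rr [c [d [lc dr fid]]].
(* Enlarging [[c, d]] guarantees [c1 < d1] even when [d <= c]. *)
pose c1 := Num.min c ((2 * l + r) / 3); pose d1 := Num.max d ((l + 2 * r) / 3).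
pose i := (2 * l' + r') / 3; pose j := (l' + 2 * r') / 3.
have [li ij jr] : [/\ l' < i, i < j & j < r'] by rewrite /i /j; split; lra.
have lc1 : l < c1 by rewrite lt_min lc; lra.
have dr1 : d1 < r by rewrite gt_max dr; lra.
have cd1 : c1 < d1 by rewrite gt_min !lt_max; apply/orP; right; apply/orP; right; lra.
have [||||u [su uc]] := @push R l r c1 i; [lra..|].
have iu : i < u d1 by rewrite -uc homeo0_lt.
have ur : u d1 < r by rewrite -(supported_id su (or_intror (lexx r))) homeo0_lt.
have [||||v [sv vd]] := @push R i r (u d1) j; [lra..|].
exists (v * u)%g; split.
  by apply: supportedM => //; apply: supported_sub sv; lra.
exists i, j; split => // x xij; rewrite !homeo0M fid -?homeo0M ?mulgK ?mulgV //.
have ki : (v * u)%g c1 = i.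
  by rewrite homeo0M uc (supported_id sv) //; left.
have kj : (v * u)%g d1 = j by rewrite homeo0M.
have xcd : (v * u)^-1%g x <= c1 \/ d1 <= (v * u)^-1%g x.
  by rewrite homeo0_leVl homeo0_leVr ki kj.
have ? : c1 <= c by rewrite ge_min lexx.
have ? : d <= d1 by rewrite le_max lexx.
by case: xcd => ?; [left|right]; lra.
Qed.

(** Equal values of [kappa] mean the same left coset of [H]. For [a1 g] and [a2 g] in one class, the
    conjugate of [a1^-1 a2] by [g^-1] is the quotient of the two, hence lies in [H]; so does the
    conjugate of a commutator of such elements. *)
Lemma countable_index_subinterval l r l1 r1 (H : G -> Prop) (kappa : G -> nat) (g : G) :
  l <= l1 -> l1 < r1 -> r1 <= r ->
  (forall f h, supported l r f -> supported l r h -> kappa f = kappa h ->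
     H (f^-1 * h)%g) ->
  (forall f h, H f -> H h -> H (f * h)%g) -> (forall f, H f -> H f^-1%g) ->
  supported l r g ->
  exists p, [/\ l1 < p.1, p.1 < p.2, p.2 < r1 &
    forall f, supported p.1 p.2 f -> H (g^-1 * f * g)%g].
Proof.
move=> ll lr rr Hk HM HV sg.
have [|l2 [r2 [k [k' [ll2 lr2 r2r HT]]]]] :=
    @diagonal_commutator l1 r1 (fun k f => kappa (f * g)%g = k) lr.
  by move=> f _; exists (kappa (f * g)%g).
exists (l2, r2); split => // f /HT[a1 [a2 [b1 [b2 []]]]].
move=> <- a2k <- b2k [sa1 sa2 sb1 sb2 ->].
have Hc (u v : G) : supported l1 r1 u -> supported l1 r1 v ->
    kappa (v * g)%g = kappa (u * g)%g -> H (g^-1 * (u^-1 * v) * g)%g.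
  move=> /(supported_sub ll rr) su /(supported_sub ll rr) sv uv.
  have := Hk _ _ (supportedM su sg) (supportedM sv sg) (esym uv).
  by rewrite invgM !mulgA.
have Ha := Hc _ _ sa1 sa2 a2k; have Hb := Hc _ _ sb1 sb2 b2k.
set a := (a1^-1 * a2)%g in Ha *; set b := (b1^-1 * b2)%g in Hb *.
have -> : (g^-1 * (a * b * a^-1 * b^-1) * g = (g^-1 * a * g) * (g^-1 * b * g) *
    (g^-1 * a * g)^-1 * (g^-1 * b * g)^-1)%g.
  by rewrite !invgM !invgK !mulgA !(mulgVK, mulgK).
by apply: (HM); [apply: (HM); [apply: (HM)|apply: HV]|apply: HV].
Qed.

Lemma nested_intervals (p : nat -> R * R) :
  (forall n, [/\ (p n).1 < (p n.+1).1, (p n).1 < (p n).2 & (p n.+1).2 < (p n).2]) ->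
  exists a, forall n, (p n).1 < a < (p n).2.
Proof.
move=> pP.
have inc : {homo (fun n => (p n).1) : m n / (m <= n)%N >-> m <= n}.
  by apply/nondecreasing_seqP => n; have [/ltW] := pP n.
have dec : {homo (fun n => (p n).2) : m n / (m <= n)%N >-> n <= m}.
  by apply/nonincreasing_seqP => n; have [_ _ /ltW] := pP n.
have lr m n : (p m).1 < (p n).2.
  apply: le_lt_trans (inc _ _ (leq_maxl m n)) _.
  apply: lt_le_trans (dec _ _ (leq_maxr m n)); by have [] := pP (maxn m n).
pose A := range (fun n => (p n).1).
have A0 : A !=set0 by exists (p 0%N).1, 0%N.
have Aub n : ubound A (p n).2 by move=> _ [m _ <-]; exact/ltW/lr.
exists (sup A) => n; apply/andP; split.
  have [+ _ _] := pP n => /lt_le_trans; apply.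
  by apply: ub_le_sup; [exists (p 0%N).2; exact: Aub|exists n.+1].
by have [_ _] := pP n; apply: le_lt_trans; apply: ge_sup.
Qed.

(* By [countable_index_subinterval] and nested intervals, some point [a] has a
   neighbourhood on which [H] is full, simultaneously for the countably many
   conjugates of [H]; by transitivity every point has one for [H] itself. *)
Lemma countable_index l r (H : G -> Prop) (kappa : G -> nat) : l < r ->
  (forall f h, supported l r f -> supported l r h -> kappa f = kappa h ->
     H (f^-1 * h)%g) ->
  (forall f h, H f -> H h -> H (f * h)%g) -> (forall f, H f -> H f^-1%g) ->
  forall f, supported l r f -> H f.
Proof.
move=> lr Hk HM HV.
have H1 : H 1%g by rewrite -(mulVg 1%g); apply: Hk => //; exact: supported1.
(* [gs n] represents the class [n] of [kappa]; it is the identity if that class is empty. *)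
have exg n : exists g : G, supported l r g /\
    forall h, supported l r h -> kappa h = n -> kappa g = n.
  have [[g [sg gn]]|nex] := pselect (exists g, supported l r g /\ kappa g = n).
    by exists g.
  exists 1%g; split=> [|h sh hn]; first exact: supported1.
  by case: nex; exists h.
have [gs gsP] := choice exg.
have exS (np : nat * (R * R)) : exists q : R * R,
    l <= np.2.1 -> np.2.1 < np.2.2 -> np.2.2 <= r ->
    [/\ np.2.1 < q.1, q.1 < q.2, q.2 < np.2.2 &
      forall f, supported q.1 q.2 f -> H ((gs np.1)^-1 * f * gs np.1)%g].
  case: np => n [l1 r1] /=.
  have [[ll lr1 rr]|] := pselect [/\ l <= l1, l1 < r1 & r1 <= r]; last first.
    by move=> nlr; exists (0, 0) => ? ? ?; case: nlr.
  have [q qP] := countable_index_subinterval ll lr1 rr Hk HM HV (gsP n).1.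
  by exists q.
have [S SP] := choice exS.
pose p := fix p n := if n is m.+1 then S (m, p m) else (l, r).
have pP n : [/\ l <= (p n).1, (p n).1 < (p n).2 & (p n).2 <= r].
  elim: n => [|n [IH1 IH2 IH3]]; first by [].
  by have [? ? ? _] := SP (n, p n) IH1 IH2 IH3; split => //=; lra.
have pS n : [/\ (p n).1 < (p n.+1).1, (p n.+1).1 < (p n.+1).2,
    (p n.+1).2 < (p n).2 & forall f, supported (p n.+1).1 (p n.+1).2 f ->
      H ((gs n)^-1 * f * gs n)%g].
  by have [h1 h2 h3] := pP n; exact: (SP (n, p n) h1 h2 h3).
have [n|a aP] := @nested_intervals p.
  by have [? ? ? _] := pS n; have [_ ? _] := pP n.
have /andP[/= la ar] := aP 0%N.
(* Let [g] send [b] to [a] and let [n = kappa g]. Then [g] and [gs n] lie in one coset, so the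
   information near [a] for the conjugate by [gs n] becomes fullness of [H] near [b]. *)
have local b : l < b -> b < r -> exists x y, [/\ x < b, b < y &
    forall f, supported x y f -> H f].
  move=> lb br; have [g [sg gb]] := push lb br la ar.
  pose n := kappa g; have [_ _ _ Hn] := pS n.
  have /andP[xa ay] := aP n.+1.
  exists (g^-1 (p n.+1).1)%g, (g^-1 (p n.+1).2)%g.
  rewrite homeo0_ltVl homeo0_ltVr gb; split => // f sf.
  have := supportedJ g sf; rewrite !homeo0VK => /Hn.
  have Hg : H ((gs n)^-1 * g)%g.
    by apply: Hk => //; [exact: (gsP n).1|exact: (gsP n).2 sg _].
  move=> /(HM _ _ (HV _ Hg)) /HM /(_ Hg).
  by rewrite invgM invgK !mulgA !(mulgVK, mulgK) mulVg mul1g.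
move=> f0 [c [d [lc dr fid]]]; pose x := (l + c) / 2; pose y := (d + r) / 2.
have [yx|xy] := ltP y x.
  have -> : f0 = 1%g.
    apply: homeo0_ext => z; rewrite homeo01 fid //.
    by have [zc|cz] := leP z c; [left|right; rewrite /x /y in yx; lra].
  by [].
(* The supremum of the [e] with [Gamma x e] inside [H] is [y]: [local] at the supremum and
   [fragmentation] would otherwise extend further. *)
pose D := [set e | x <= e <= y /\ forall f, supported x e f -> H f].
have Dx : D x.
  split; first by rewrite lexx xy.
  move=> f [c' [d' [xc' dx' fid']]]; have -> : f = 1%g; last by [].
  apply: homeo0_ext => z; rewrite homeo01 fid' //.
  by have [zc|cz] := leP z c'; [left|right; lra].
have Dub : ubound D y by move=> e [/andP[]].
pose s := sup D.
have Dsup : has_sup D by split; [exists x|exists y].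
have xs : x <= s by apply: ub_le_sup => //; exists y.
have sy : s <= y by apply: ge_sup => //; exists x.
have [||u [v [us sv Huv]]] := local s; rewrite /x /y in xs sy *; [lra..|].
have su0 : 0 < s - u by lra.
have [e [/andP[xe ey] De] ue] := sup_adherent su0 Dsup.
rewrite -/s subKr in ue.
have es : e <= s by apply: ub_le_sup; [exists y|split=> //; rewrite xe ey].
pose e' := Num.min v y.
have ee' : e <= e' by rewrite le_min ey andbT; lra.
have De' : D e'.
  split; first by rewrite (le_trans xe ee') ge_min lexx orbT.
  move=> f sf; have e'v : e' <= v by rewrite ge_min lexx.
  have [ux|xu] := ltP u x; first by apply: Huv; apply: supported_sub sf => //;
    exact: ltW.
  apply: (fragmentation xu ue ee') sf => // g sg.
  by apply: Huv; apply: supported_sub sg.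
have e's : e' <= s by apply: ub_le_sup => //; exists y.
have ey' : e' = y by move: e's; rewrite /e'; case: (leP v y) => //; lra.
apply: (De'.2); rewrite ey'.
by exists c, d; split => //; rewrite /x /y; lra.
Qed.
End Algebra.

(** * One-dimensional manifolds *)

Section Topology.
Variables (R : realType) (N : topologicalType).
Implicit Types (A B O W : set N) (p q : N) (psi : R -> N) (s t a b : R).

(** Otherwise the stabilizer of [0] would have countable index in [Gamma (-1) 1], hence be the whole
    group, although some element moves [0]. *)
Lemma real_uncountable (k : R -> nat) : ~ injective k.
Proof.
move=> kinj; have [||||g [sg g0]] := @push R (-1) 1 0 (1 / 2); [lra..|].
suff : g 0 = 0 by rewrite g0; lra.
apply: (@countable_index R (-1) 1 (fun f : Homeo0 R R => f 0 = 0)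
  (fun f : Homeo0 R R => k (f 0))) sg => [|f h _ _ /kinj fh|f h f0 h0|f f0].
- lra.
- by rewrite homeo0M -fh homeo0K.
- by rewrite homeo0M h0.
- by rewrite -{1}f0 homeo0K.
Qed.

(** Numbers that label no basic set are given the empty set. *)
Lemma countable_basis : @second_countable N -> exists b : nat -> set N,
  (forall n, open (b n)) /\
  forall O x, open O -> O x -> exists n, b n x /\ b n `<=` O.
Proof.
move=> [B /countable_injP[f finj] [Bo Bb]].
pose P n V := B V /\ f V = n.
exists (fun n => xget set0 [set V | P n V]); split.
  move=> n; case: xgetP => [V -> [BV _]|_]; [exact: Bo|exact: open0].
move=> O x oO Ox; have [|V /= [BV Vx] VO] := Bb x O; first exact: open_nbhs_nbhs.
exists (f V); suff -> : xget set0 [set W | P (f V) W] = V by [].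
case: xgetP => [W -> [BW fW]|/(_ V)]; last by case.
by apply: finj => //; rewrite inE.
Qed.

(** The traces of [A] and [B] on [W] coincide, so this trace is both open and closed in [W]. *)
Lemma connected_subset_clopen A B W :
  connected W -> open A -> closed B -> A `<=` B -> W `&` B `<=` A ->
  W `&` A !=set0 -> W `<=` A.
Proof.
move=> cW oA cB AB WBA WA0.
have -> : W = W `&` A; last exact: subIsetr.
apply/esym/cW => //; first by exists A.
exists B => //; apply/seteqP; split=> x [Wx Hx]; split => //; first exact: AB.
exact: WBA.
Qed.

Definition chart p O psi : Prop :=
  [/\ psi 0 = p, forall t, -1 < t < 1 -> O (psi t),
      forall t, -1 < t < 1 -> psi x @[x --> t] --> psi t,
      forall s t, -1 < s < 1 -> -1 < t < 1 -> psi s = psi t -> s = t &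
      forall T : set R, open T -> (forall t, T t -> -1 < t < 1) -> open (psi @` T)].

Lemma chart_exists p O (U : set N) (V : set R) : open O -> O p -> open U -> U p ->
  open V -> homeo U V -> exists psi, chart p O psi.
Proof.
move=> oO Op oU Up oV h.
pose up : U := exist _ p (mem_set Up).
pose t0 : R := set_val (h up).
have Vt0 : V t0 by exact: set_mem (svalP (h up)).
(* The inverse of [h], extended by the constant [p] outside [V]; it is later rescaled from a ball
   around [t0] to []-1, 1[]. *)
pose psi0 t := if pselect (V t) is left Vt
  then set_val (homeo_inv h (exist _ t (mem_set Vt))) else p.
have psi0E (v : V) : psi0 (set_val v) = set_val (homeo_inv h v).
  rewrite /psi0; case: pselect => [Vt|]; last by case; exact: set_mem (svalP v).
  by congr (set_val (homeo_inv h _)); apply: val_inj.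
have psi0V t : V t -> exists u : U, psi0 t = set_val u /\ set_val (h u) = t.
  move=> Vt; pose v : V := exist _ t (mem_set Vt).
  by exists (homeo_inv h v); rewrite homeo_invK -[t]/(set_val v) psi0E.
have psi0t0 : psi0 t0 = p by rewrite psi0E homeo_funK.
have psi0c t : V t -> psi0 x @[x --> t] --> psi0 t.
  move=> Vt W; pose v : V := exist _ t (mem_set Vt).
  rewrite -[t in psi0 t]/(set_val v) psi0E => nW.
  have : nbhs v (fun v' : V => W (set_val (homeo_inv h v'))).
    exact: (@homeo_inv_continuous _ _ h v _ (@initial_continuous U N set_val _ _ nW)).
  move=> [_ [/= [T oT <-] /= Tt sub]].
  have : nbhs t (V `&` T) by apply: open_nbhs_nbhs; split=> //; exact: openI.
  apply: filterS => s [Vs Ts] /=.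
  have := sub (exist _ s (mem_set Vs)) Ts.
  by rewrite -psi0E.
have psi0o (T : set R) : open T -> T `<=` V -> open (psi0 @` T).
  move=> oT TV; rewrite openE => _ [t Tt <-].
  have [u [-> hu]] := psi0V t (TV _ Tt).
  have : nbhs u (fun u' : U => T (set_val (h u'))).
    have nT : nbhs (set_val (h u)) T by apply: open_nbhs_nbhs; rewrite hu.
    exact: (@homeo_continuous _ _ h u _ (@initial_continuous V R set_val _ _ nT)).
  move=> [_ [/= [W oW <-] /= Wu sub]].
  have : nbhs (set_val u) (U `&` W).
    by apply: open_nbhs_nbhs; split; [exact: openI|split=> //;
      exact: set_mem (svalP u)].
  apply: filterS => q [Uq Wq].
  pose uq : U := exist _ q (mem_set Uq).
  by exists (set_val (h uq)); [exact: (sub uq)|rewrite psi0E homeo_funK].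
have : nbhs t0 (V `&` psi0 @^-1` O).
  apply: filterI; first exact: open_nbhs_nbhs.
  by apply: psi0c => //; apply: open_nbhs_nbhs; rewrite psi0t0.
move=> /nbhs_ballP[e /= e0 sub].
have ball_t t : -1 < t < 1 -> V (t0 + e * t) /\ O (psi0 (t0 + e * t)).
  move=> /andP[t1 t2]; apply: sub; rewrite /ball /= opprD addNKr normrN normrM.
  by rewrite gtr0_norm // -[ltRHS]mulr1 ltr_pM2l // ltr_norml t1.
have affc t : (t0 + e * x) @[x --> t] --> t0 + e * t.
  by apply: cvgD; [exact: cvg_cst|apply: cvgM; [exact: cvg_cst|exact: cvg_id]].
exists (fun t => psi0 (t0 + e * t)); split.
- by rewrite mulr0 addr0.
- by move=> t /ball_t[].
- move=> t /ball_t[Vt _].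
  by apply: (continuous_comp (affc t)); exact: psi0c.
- move=> s t /ball_t[/psi0V[u [-> hu]] _] /ball_t[/psi0V[v [-> hv]] _] /val_inj uv.
  by move: hv; rewrite -uv hu => /addrI/mulfI; apply; rewrite gt_eqF.
- move=> T oT T1.
  have -> : (fun t => psi0 (t0 + e * t)) @` T = psi0 @` ((fun s => (s - t0) / e)
    @^-1` T).
    apply/seteqP; split => [_ [t Tt <-]|_ [s Ts <-]].
      exists (t0 + e * t) => //=.
      by rewrite addrAC subrr add0r mulrC mulKf ?gt_eqF.
    exists ((s - t0) / e) => //.
    by rewrite mulrC divfK ?gt_eqF // addrC subrK.
  apply: psi0o.
    apply: open_comp => // s _; apply: cvgM; last exact: cvg_cst.
    by apply: cvgB; [exact: cvg_id|exact: cvg_cst].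
  move=> s /= /T1 /ball_t[+ _].
  by rewrite mulrC divfK ?gt_eqF // addrC subrK.
Qed.

Hypothesis hausdorffN : hausdorff_space N.
Hypothesis chartN : forall p O, open O -> O p -> exists psi, chart p O psi.

Lemma chart_within p O psi (T : set R) : chart p O psi ->
  (forall t, T t -> -1 < t < 1) -> {within T, continuous psi}.
Proof.
move=> [_ _ psic _ _] T1; apply: continuous_in_subspaceT => t.
by rewrite inE => /T1; exact: psic.
Qed.

Lemma chart_segment_compact p O psi a b : chart p O psi -> -1 < a -> b < 1 ->
  compact (psi @` `[a, b]).
Proof.
move=> cpsi a1 b1; apply: continuous_compact; last exact: segment_compact.
by apply: chart_within cpsi _ => t /=; rewrite in_itv /=; lra.
Qed.

Lemma chart_open_itv p O psi a b : chart p O psi -> -1 <= a -> b <= 1 ->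
  open (psi @` `]a, b[).
Proof.
move=> [_ _ _ _ psio] a1 b1; apply: psio; first exact: itv_open.
by move=> t /=; rewrite in_itv /=; lra.
Qed.

Lemma chart_itv_connected p O psi a b : chart p O psi -> -1 <= a -> b <= 1 ->
  connected (psi @` `]a, b[).
Proof.
move=> cpsi a1 b1; apply: connected_continuous_connected.
  exact/connected_intervalP/interval_is_interval.
by apply: chart_within cpsi _ => t /=; rewrite in_itv /=; lra.
Qed.

Lemma component_open A p : open A -> open (connected_component A p).
Proof.
move=> oA; rewrite openE => q Cq.
have Aq : A q by apply: connected_component_sub Cq.
have [psi cpsi] := chartN oA Aq.
have mem0 : `]-1, 1[%classic (0 : R) by rewrite /= in_itv /=; lra.
have psi0 : psi 0 = q by case: cpsi.
apply: (@filterS _ _ _ (psi @` `]-1, 1[)); last first.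
  apply: open_nbhs_nbhs; split; first exact: chart_open_itv cpsi _ _.
  by exists 0.
rewrite (same_connected_component Cq).
apply: (connected_component_max (x := q)).
- by exists 0.
- by move=> _ [t + <-]; rewrite /= in_itv /= => t1; case: cpsi => _ + _ _ _; apply.
- exact: chart_itv_connected cpsi _ _.
Qed.

(** A chart contains at most two boundary points of [W], so they are isolated. Given three, [W] has
    a point near the middle one, in one of the two gaps; being connected, [W] is trapped in that
    gap, so its closure misses the third point. *)
Lemma boundary_isolated W q : connected W -> open W -> closure W q -> ~ W q ->
  exists B, [/\ open B, B q & forall v, B v -> closure W v -> ~ W v -> v = q].
Proof.
move=> cW oW clq nWq.
have [psi cpsi] := chartN openT (I : [set: N] q).
have [psi0 _ _ psi_inj _] := cpsi.
have clo a b : -1 < a -> b < 1 -> closed (psi @` `[a, b]).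
  by move=> a1 b1; apply: compact_closed => //; exact: chart_segment_compact cpsi _ _.
pose D t := [/\ -1 < t < 1, closure W (psi t) & ~ W (psi t)].
have trap s t : D s -> D t -> s < t -> W `&` (psi @` `]s, t[) !=set0 ->
    closure W `<=` psi @` `[s, t].
  move=> [s1 _ nWs] [t1 _ nWt] st WJ.
  have sub : psi @` `]s, t[ `<=` psi @` `[s, t].
    by apply: image_subset; apply: subset_itv_oo_cc.
  have cst : closed (psi @` `[s, t]) by apply: clo; [case/andP: s1|case/andP: t1].
  rewrite [X in _ `<=` X](closure_id _).1 //; apply: closure_subset.
  apply: (subset_trans _ sub).
  apply: (connected_subset_clopen (B := psi @` `[s, t]) cW) WJ => //.
  - by apply: chart_open_itv cpsi _ _; lra.
  - move=> v [Wv [u ust uE]]; rewrite -{}uE in Wv *; exists u => //.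
    move: ust; rewrite /= !in_itv /= => /andP[su ut].
    rewrite !lt_neqAle su ut !andbT; apply/andP; split.
      by apply: contra_notN nWs => /eqP ->.
    by apply: contra_notN nWt => /eqP <-.
have notin t s r : -1 < t < 1 -> -1 < s -> r < 1 -> ~ (s <= t <= r) ->
    ~ (psi @` `[s, r]) (psi t).
  move=> t1 s1 r1 nt [u + /psi_inj ut]; rewrite /= in_itv /= => usr.
  by apply: nt; rewrite -ut //; lra.
have no3 s t u : D s -> D t -> D u -> s < t -> t < u -> False.
  move=> Ds Dt Du st tu; have [s1 cls _] := Ds; have [t1 clt nWt] := Dt.
  have [u1 clu _] := Du.
  have [|v [Wv [w + wE]]] := clt (psi @` `]s, u[).
    apply: open_nbhs_nbhs; split; first by apply: chart_open_itv cpsi _ _; lra.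
    by exists t => //; rewrite /= in_itv /= st.
  rewrite -wE in Wv; rewrite /= in_itv /= => /andP[sw wu].
  have [wt|tw|wt] := ltgtP w t.
  - apply: (notin u s t) => //; [lra..|].
    apply: (trap _ _ Ds Dt) => //; exists (psi w); split => //; exists w => //.
    by rewrite /= in_itv /= sw.
  - apply: (notin s t u) => //; [lra..|].
    apply: (trap _ _ Dt Du) => //; exists (psi w); split => //; exists w => //.
    by rewrite /= in_itv /= tw.
  - by rewrite wt in Wv.
have D0 : D 0 by split; rewrite ?psi0 //; lra.
have finish e : 0 < e <= 1 -> (forall t, `|t| < e -> D t -> t = 0) ->
    exists B, [/\ open B, B q & forall v, B v -> closure W v -> ~ W v -> v = q].
  move=> e1 eD; exists (psi @` `]-e, e[); split.
  - by apply: chart_open_itv cpsi _ _; lra.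
  - by exists 0 => //; rewrite /= in_itv /=; lra.
  - move=> _ [t + <-]; rewrite /= in_itv /= => te clt nWt.
    by rewrite (eD t) //; [rewrite ltr_norml|split => //; lra].
have [[t [Dt tn0]]|none] := pselect (exists t, D t /\ t != 0); last first.
  apply: (finish 1) => [|t _ Dt]; first lra.
  by apply/eqP/negP => tn0; apply: none; exists t; split=> //; apply/negP.
apply: (finish `|t|).
  by rewrite normr_gt0 tn0 ltW // ltr_norml; case: Dt.
move=> s st Ds; apply/eqP; apply: contraT => sn0.
have [s0|s0|s0] := ltgtP s 0; last by rewrite s0 eqxx in sn0.
  have [t0|t0|t0] := ltgtP t 0; last by rewrite t0 eqxx in tn0.
    by exfalso; apply: (no3 t s 0) => //; move: st; rewrite !ltr0_norm // ltrN2.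
  by exfalso; apply: (no3 s 0 t).
have [t0|t0|t0] := ltgtP t 0; last by rewrite t0 eqxx in tn0.
  by exfalso; apply: (no3 t 0 s).
by exfalso; apply: (no3 0 s t) => //; move: st; rewrite !gtr0_norm.
Qed.

End Topology.

(** * Actions on one-dimensional manifolds *)

Section Action.
Variables (R : realType) (N : topologicalType).
Local Notation G := (Homeo0 R R).
Hypothesis hausdorffN : hausdorff_space N.
Hypothesis chartN : forall (p : N) O, open O -> O p -> exists psi : R
  -> N, chart p O psi.
Variable b : nat -> set N.
Hypothesis b_open : forall n, open (b n).
Hypothesis b_basis : forall O x, open O -> O x -> exists n, b n x /\ b n `<=` O.
Variable act : G -> N -> N.
Hypothesis actM : forall f g x, act (f * g)%g x = act f (act g x).
Hypothesis act1 : forall x, act 1%g x = x.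
Hypothesis act_continuous : forall f, continuous (act f).
Implicit Types (f g h : G) (l r : R) (p q : N) (U W Z O : set N).

Lemma actK f x : act f^-1%g (act f x) = x.
Proof. by rewrite -actM mulVg act1. Qed.

Lemma actVK f x : act f (act f^-1%g x) = x.
Proof. by rewrite -actM mulgV act1. Qed.

Lemma act_preimage_open f O : open O -> open (act f @^-1` O).
Proof. by move=> oO; apply: open_comp => // x _; exact: act_continuous. Qed.

Lemma act_connected f W : connected W -> connected (act f @` W).
Proof.
move=> cW; apply: connected_continuous_connected => //.
by apply: continuous_subspaceT; exact: act_continuous.
Qed.

Lemma closed_fixed f : closed [set q | act f q = q].
Proof.
rewrite -[X in closed X]setCK; apply: open_closedC.
rewrite openE => q /= /eqP nq.
move: hausdorffN; rewrite open_hausdorff => /(_ _ _ nq).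
move=> [[A B] /= [/set_mem Aq /set_mem Bq] [oA oB /eqP AB]].
have : nbhs q (act f @^-1` A `&` B).
  by apply: open_nbhs_nbhs; split=> //; apply: openI => //; exact: act_preimage_open.
apply: filterS => x [/= Ax Bx] fx.
have : (A `&` B) x by split=> //; rewrite -fx.
by rewrite AB.
Qed.

(** * Invariant closed sets and the components of their complements *)

Definition invariant_under l r Z :=
  forall f, supported l r f -> forall z, Z z -> Z (act f z).

Lemma invariant_underC l r Z : invariant_under l r Z -> invariant_under l r (~` Z).
Proof.
move=> iZ f sf z nz Zf; apply: nz; rewrite -(actK f z).
by apply: iZ => //; exact: supportedV.
Qed.

(** [kappa g] numbers a basic open set inside the translate of [W] by [g]. Translates are components
    of the complement of [Z], so equal numbers mean equal translates: the stabilizer of [W] has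
    countable index. *)
Lemma component_invariant l r Z y : l < r -> closed Z -> invariant_under l r Z ->
  invariant_under l r (connected_component (~` Z) y).
Proof.
move=> lr cZ iZ f sf w Ww; set W := connected_component _ _ in Ww *.
have oW : open W by apply: (component_open chartN); exact: closed_openC.
have cW : connected W by exact: component_connected.
have WZ : W `<=` ~` Z by exact: connected_component_sub.
have iZC := invariant_underC iZ.
(* An element that keeps one point of [W] in [W] maps all of [W] into [W]. *)
have stab k v : supported l r k -> W v -> W (act k v) -> forall x, W x -> W (act k x).
  move=> sk Wv Wkv x Wx.
  have -> : W = connected_component (~` Z) (act k v).
    by apply: same_connected_component.
  apply: (@connected_component_max _ _ (act k @` W));
    [exists v| |exact: act_connected|exists x] => //.
  by move=> _ [u Wu <-]; apply: iZC => //; exact: WZ.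
have ex g : exists n, b n (act g w) /\ b n `<=` act g^-1%g @^-1` W.
  by apply: b_basis; [exact: act_preimage_open|rewrite /= actK].
have [kappa kP] := choice ex.
suff : forall x, W x <-> W (act f x) by move/(_ w)/proj1; exact.
apply: (@countable_index R l r (fun g => forall x, W x <-> W (act g x)) kappa) sf => //.
- move=> g h sg sh gh.
  have [bg sub_g] := kP g; have [_ sub_h] := kP h; rewrite -gh in sub_h.
  have Wg := sub_g _ bg; have Wh := sub_h _ bg; rewrite /= in Wg Wh.
  have sk : supported l r (g^-1 * h)%g by apply: supportedM => //; exact: supportedV.
  have Wk : W (act (g^-1 * h)%g (act h^-1%g (act g w))) by rewrite actM actVK.
  move=> x; split; first exact: stab Wk x.
  have sk' := supportedV sk.
  move=> Wkx; rewrite -(actK (g^-1 * h)%g x).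
  by apply: (stab _ _ sk' Wk) => //; rewrite actK.
- by move=> g h Hg Hh x; rewrite actM -Hg -Hh.
- by move=> g Hg x; rewrite (Hg (act g^-1%g x)) actVK.
Qed.

(** The orbit of [q] consists of boundary points of the invariant set [W]. These are isolated in the
    boundary, so basic open sets number them and the stabilizer of [q] has countable index. *)
Lemma boundary_fixed l r Z y q f : l < r -> closed Z -> invariant_under l r Z ->
  closure (connected_component (~` Z) y) q ->
  ~ connected_component (~` Z) y q -> supported l r f -> act f q = q.
Proof.
move=> lr cZ iZ; have iW := component_invariant (y := y) lr cZ iZ.
have iWC := invariant_underC iW.
set W := connected_component _ _ => clq nWq sf.
have oW : open W by apply: (component_open chartN); exact: closed_openC.
have cW : connected W by exact: component_connected.
have icl g : supported l r g -> closure W (act g q).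
  move=> sg A /(act_continuous (f := g)) /= /clq [x [Wx Ax]].
  by exists (act g x); split => //; exact: iW.
have ex g : exists n, supported l r g -> b n (act g q) /\
    forall v, b n v -> closure W v -> ~ W v -> v = act g q.
  have [sg|nsg] := pselect (supported l r g); last by exists 0%N.
  have [B [oB Bq HB]] := boundary_isolated hausdorffN chartN cW oW (icl _ sg) (iWC _
    sg _ nWq).
  by have [n [bq bB]] := b_basis oB Bq; exists n => _; split => // v /bB; exact: HB.
have [kappa kP] := choice ex.
apply: (@countable_index R l r (fun g => act g q = q) kappa) sf => //.
- move=> g h sg sh gh; have [_ Hg] := kP g sg; have [Hh _] := kP h sh.
  rewrite -gh in Hh; rewrite actM (Hg _ Hh) ?actK //; first exact: icl.
  exact: iWC.
- by move=> g h gq hq; rewrite actM hq.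
- by move=> g gq; rewrite -{1}gq actK.
Qed.

(** If [y] in [U] lies outside [Z], its component [W] in the complement of [Z] has only fixed
    boundary points. None of them is in [U], so [U] stays inside [W] and cannot meet [Z]. *)
Lemma connected_free_subset l r Z U : l < r -> closed Z -> invariant_under l r Z ->
  connected U -> (forall u, U u -> exists2 f, supported l r f & act f u <> u) ->
  U `&` Z !=set0 -> U `<=` Z.
Proof.
move=> lr cZ iZ cU free [z [Uz Zz]] y Uy; apply: contrapT => nZy.
set W := connected_component (~` Z) y.
have oW : open W by apply: (component_open chartN); exact: closed_openC.
have Wy : W y by exact: connected_component_refl.
suff UW : U `<=` W by have := connected_component_sub (UW _ Uz).
apply: (connected_subset_clopen (B := closure W) cU) => //.
- exact: closed_closure.
- exact: subset_closure.
- move=> u [Uu clu]; apply: contrapT => nWu.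
  have [f sf fu] := free _ Uu; apply: fu; exact: boundary_fixed clu nWu sf.
- by exists y.
Qed.

(** * Small orbits and commuting subgroups *)

(** By compactness, a finite union of basic sets fits between the image of [[c, d]] and [O]. Finite
    lists of indices are countably many, so they can label a countable cover of the group. *)
Lemma basis_sandwich (F : R -> N) (c d : R) O : -1 < c -> d < 1 ->
  (forall t : R, -1 < t < 1 -> F x @[x --> t] --> F t) -> open O ->
  (forall t, c <= t <= d -> O (F t)) ->
  exists s : seq nat, (forall t, c <= t <= d -> exists2 n, n \in s & b n (F t)) /\
    forall n, n \in s -> b n `<=` O.
Proof.
move=> c1 d1 Fc oO FO.
pose D := [set n | b n `<=` O].
pose C n := [set t : R | -1 < t < 1 /\ b n (F t)].
have oC n : open (C n).
  rewrite openE => t [t1 bt].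
  have : nbhs t (`]-1, 1[%classic `&` F @^-1` b n).
    apply: filterI; first by apply: open_nbhs_nbhs; split; [exact: itv_open|
      rewrite /= in_itv].
    by apply: Fc => //; apply: open_nbhs_nbhs.
  by apply: filterS => u [/=]; rewrite in_itv.
have := @segment_compact R c d; rewrite compact_cover => /(_ nat D C).
have covC : `[c, d] `<=` cover D C.
  move=> t; rewrite /= in_itv /= => tcd; have t1 : -1 < t < 1 by lra.
  by have [n [bn bO]] := b_basis oO (FO _ tcd); exists n.
move=> /(_ (fun i _ => oC i) covC) [E ED EC].
exists (finmap.enum_fset E); split.
  move=> t tcd; have [|n /= nE [_ bn]] := EC t; first by rewrite /= in_itv.
  by exists n.
by move=> n nE; have := ED n nE; rewrite inE.
Qed.

(* The neighbourhoods [K 0, ..., K 4] leave room for the four successive factors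
   of the commutators given by [diagonal_commutator]. *)
Lemma small_orbits p O l r : open O -> O p -> l < r ->
  exists l' r', [/\ l < l', l' < r', r' < r &
    forall f, supported l' r' f -> O (act f p)].
Proof.
move=> oO Op lr; have [psi cpsi] := chartN oO Op; have [psi0 psiO psic _ _] := cpsi.
(* The radii run from [1/6] to [5/6] for the indices 0 to 4, all inside the chart. *)
pose e i : R := i.+1%:R / 6.
pose K i := psi @` `[- e i, e i].
pose V i := psi @` `]- e i, e i[.
have e_lt i : e i < e i.+1 by rewrite /e ltr_pM2r ?ltr_nat // invr_gt0.
have e0 i : 0 < e i by rewrite /e divr_gt0.
have e1 i : (i < 5)%N -> e i < 1.
  by move=> i5; rewrite /e ltr_pdivrMr // mul1r ltr_nat ltnS.
have oV i : (i < 5)%N -> open (V i).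
  move=> /e1 ei; apply: chart_open_itv cpsi _ _; lra.
(* The list [s_i] is sandwiched between the images under [f] of [K i] and [V i.+1]. If [f] and [g]
   share [s], then [f^-1 g] maps [K i] into [K i.+1]. *)
pose T (s : seq (seq nat)) f := forall i, (i < 4)%N ->
  (forall x, K i x -> exists2 n, n \in nth [::] s i & b n (act f x)) /\
  (forall n, n \in nth [::] s i -> b n `<=` act f^-1%g @^-1` V i.+1).
have exT f : exists s, T s f.
  have ex i : exists s : seq nat, (i < 4)%N ->
      (forall x, K i x -> exists2 n, n \in s & b n (act f x)) /\
      (forall n, n \in s -> b n `<=` act f^-1%g @^-1` V i.+1).
    have [i4|i4] := ltnP i 4; last by exists [::].
    have ei := e1 i.+1 i4; have ei' := e_lt i; have ei0 := e0 i.
    have [|||||s [s1 s2]] := @basis_sandwich (act f \o psi) (- e i) (e i)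
        (act f^-1%g @^-1` V i.+1).
    - lra.
    - lra.
    - by move=> t t1; apply: continuous_comp; [exact: psic|exact: act_continuous].
    - by apply: act_preimage_open; exact: oV.
    - by move=> t tei; rewrite /= actK; exists t => //; rewrite /= in_itv /=; lra.
    - exists s => _; split=> // _ [t + <-]; rewrite /= in_itv /=; exact: s1.
  have [s sP] := choice ex; exists (mkseq s 4) => i i4.
  by rewrite nth_mkseq //; exact: sP.
have Tk s f g i x : T s f -> T s g -> (i < 4)%N -> K i x -> K i.+1 (act (f^-1 * g)%g x).
  move=> Tf Tg i4 Kx; have [/(_ _ Kx) [n ns bn] _] := Tg _ i4.
  have [_ /(_ _ ns _ bn)] := Tf _ i4.
  rewrite actM; apply: image_subset; exact: subset_itv_oo_cc.
have [|l' [r' [k [k' [ll lr' rr H]]]]] := @diagonal_commutator R l r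
    (fun k f => exists2 s, unpickle k = Some s & T s f) lr.
  by move=> f _; have [s Ts] := exT f; exists (pickle s), s => //; rewrite pickleK.
exists l', r'; split => // f /H[a1 [a2 [b1 [b2 [Ta1 Ta2 Tb1 Tb2 [_ _ _ _ ->]]]]]].
have move_up (c1 c2 : G) j i x : (exists2 s, unpickle j = Some s & T s c1) ->
    (exists2 s, unpickle j = Some s & T s c2) -> (i < 4)%N ->
    K i x -> K i.+1 (act (c1^-1 * c2)%g x).
  by move=> [s js Tc1] [s' js' Tc2]; move: js'; rewrite js => -[ss'];
    rewrite -ss' in Tc2; exact: (Tk s).
have K0 : K 0%N p by exists 0 => //; rewrite /= in_itv /=; have := e0 0%N; lra.
have : K 4 (act (a1^-1 * a2 * (b1^-1 * b2) * (a1^-1 * a2)^-1 * (b1^-1 * b2)^-1)%g p).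
  rewrite [act _ _]actM [act _ (act _ _)]actM [act (_ * (_ * _))%g _]actM.
  (* The inverse of [a1^-1 a2] is [a2^-1 a1], again a quotient of two elements of one class, so
     [move_up] handles all four factors. *)
  rewrite !invgM !invgK.
  apply: (move_up _ _ _ _ _ Ta1 Ta2) => //; apply: (move_up _ _ _ _ _ Tb1 Tb2) => //.
  apply: (move_up _ _ _ _ _ Ta2 Ta1) => //; exact: (move_up _ _ _ _ _ Tb2 Tb1).
move=> [t + <-]; rewrite /= in_itv /= => t4; apply: psiO.
by have := e1 4%N isT; lra.
Qed.

Lemma closed_common_fixed (P : G -> Prop) : closed [set q | forall f, P f
  -> act f q = q].
Proof.
have -> : [set q | forall f, P f -> act f q = q] =
    \bigcap_(f in P) [set q | act f q = q].
  by apply/seteqP; split=> [q H f Pf|q H f Pf]; exact: H.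
by apply: closed_bigI => f _; exact: closed_fixed.
Qed.

(** Suppose both groups move [p], and let [U] be the component of [p] off the fixed set of the
    second group. A subgroup of the first with small orbits has to act trivially on [U], and [f1] is
    conjugate into that subgroup. *)
Lemma commuting_fixed l1 r1 l2 r2 p f1 : l1 < r1 -> l2 < r2 ->
  (forall f g, supported l1 r1 f -> supported l2 r2 g -> (f * g = g * f)%g) ->
  supported l1 r1 f1 -> act f1 p <> p -> forall g, supported l2 r2 g -> act g p = p.
Proof.
move=> lr1 lr2 comm sf1 f1p g sg; apply: contrapT => gp.
pose Fix2 := [set q | forall f, supported l2 r2 f -> act f q = q].
have cFix2 : closed Fix2 by exact: closed_common_fixed.
have iFix2 : invariant_under l1 r1 Fix2.
  by move=> f sf z Hz h sh; rewrite -actM -comm // actM Hz.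
pose U := connected_component (~` Fix2) p.
have Up : U p by apply: connected_component_refl => /(_ g sg).
have cU : connected U by exact: component_connected.
have freeU u : U u -> exists2 f, supported l2 r2 f & act f u <> u.
  move=> /(@connected_component_sub _ _ _ _) nu; apply: contrapT => nex;
    apply: nu => f sf.
  by apply: contrapT => fu; apply: nex; exists f.
have iU : invariant_under l1 r1 U by exact: component_invariant.
(* The fixed set of [h] is closed and invariant under the second group, which has no common fixed
   point in [U]; so it contains [U] as soon as it meets it. *)
have dich h u : supported l1 r1 h -> U u -> act h u = u -> forall x, U x -> act h x = x.
  move=> sh Uu hu x Ux; have iZ : invariant_under l2 r2 [set q | act h q = q].
    by move=> f sf z /= hz; rewrite -actM comm // actM hz.
  by apply: (connected_free_subset lr2 (@closed_fixed h) iZ cU freeU _ Ux); exists u.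
have Uq : U (act f1 p) by exact: iU.
have [V [oO Op ncl]] : exists V : set N, [/\ open V, V p & ~ closure V (act f1 p)].
  have /eqP pq : p <> act f1 p by move=> /esym.
  move: hausdorffN; rewrite open_hausdorff => /(_ _ _ pq).
  move=> [[A B] /= [/set_mem Ap /set_mem Bq] [oA oB /eqP AB]].
  exists A; split => // /(_ B (open_nbhs_nbhs (conj oB Bq))) [x ABx].
  by move: ABx; rewrite AB.
have [l' [r' [ll lr' rr small]]] := small_orbits oO Op lr1.
have sub' h : supported l' r' h -> supported l1 r1 h by apply: supported_sub;
  exact: ltW.
(* Without a common fixed point in [U], the closure of the small orbit of [p] would contain [U],
   hence [act f1 p], which was kept out of the closure of [V]. *)
have triv h : supported l' r' h -> forall x, U x -> act h x = x.
  move=> sh; have [[s [Us sfix]]|nofix] := pselect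
      (exists s, U s /\ forall f, supported l' r' f -> act f s = s).
    by apply: (dich h s) => //; [exact: sub'|exact: sfix].
  exfalso; apply: ncl.
  pose orb := [set x | exists2 f, supported l' r' f & x = act f p].
  have orbO : orb `<=` V by move=> _ [f sf ->]; exact: small.
  apply: (closure_subset orbO).
  apply: (@connected_free_subset l' r' (closure orb) U) => //.
  - exact: closed_closure.
  - move=> f sf z clz A /(act_continuous (f := f)) /= /clz [_ [[k sk ->] Ax]].
    exists (act f (act k p)); split => //; exists (f * k)%g; last by rewrite actM.
    exact: supportedM.
  - move=> u Uu; apply: contrapT => nf; apply: nofix; exists u; split => // f sf.
    by apply: contrapT => fu; apply: nf; exists f.
  - exists p; split => //; apply: subset_closure; exists 1%g; last by rewrite act1.
    exact: supported1.
have [k [sk sk']] := squeeze ll lr' rr sf1.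
have := triv _ sk' (act k p) (iU _ sk _ Up).
by rewrite -actM mulgVK actM => /(congr1 (act k^-1%g)); rewrite !actK.
Qed.

(** * The centre of a moved point *)

Definition fixed_left p (c : R) := forall l f, supported l c f -> act f p = p.
Definition fixed_right p (c : R) := forall r f, supported c r f -> act f p = p.
Definition moved : set N := [set p | exists f, act f p <> p].

Lemma not_moved p : (forall f, act f p = p) -> ~ moved p.
Proof. by move=> H [f]. Qed.

Lemma open_moved : open moved.
Proof.
have -> : moved = ~` [set q | forall f, True -> act f q = q].
  apply/seteqP; split=> [q [f fq] H|q H]; first exact: fq (H f I).
  by apply: contrapT => nq; apply: H => f _; apply: contrapT => fq; apply: nq; exists f.
exact/closed_openC/closed_common_fixed.
Qed.

Lemma moved_act g p : moved p -> moved (act g p).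
Proof.
move=> [f fp]; exists (g * f * g^-1)%g; rewrite -actM mulgVK actM => H; apply: fp.
by rewrite -(actK g (act f p)) H actK.
Qed.

Lemma fixed_left_sub p c c' : c <= c' -> fixed_left p c' -> fixed_left p c.
Proof. by move=> cc H l f sf; apply: (H l); exact: supported_sub sf. Qed.

Lemma fixed_right_sub p c c' : c <= c' -> fixed_right p c -> fixed_right p c'.
Proof. by move=> cc H r f sf; apply: (H r); exact: supported_sub sf. Qed.

(** Elements supported on opposite sides of [c] commute, so they cannot both move [p]. *)
Lemma fixed_left_or_right p c : fixed_left p c \/ fixed_right p c.
Proof.
apply: contrapT => /not_orP[/existsNP[l /existsNP[f /not_implyP[sf fp]]] nR].
apply: nR => r g sg; pose l' := Num.min l (c - 1); pose r' := Num.max r (c + 1).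
have l'l : l' <= l by rewrite ge_min lexx.
have rr' : r <= r' by rewrite le_max lexx.
have l'c : l' < c by rewrite gt_min; apply/orP; right; lra.
have cr' : c < r' by rewrite lt_max; apply/orP; right; lra.
apply: (commuting_fixed l'c cr' _ (supported_sub l'l (lexx c) sf) fp).
  by move=> ? ?; exact: supported_commute.
exact: supported_sub sg.
Qed.

(** The half-lines overlap in []c, c'[], so [fragmentation] generates every element from those
    fixing [p]. *)
Lemma fixed_left_right p c c' : c < c' -> fixed_left p c' -> fixed_right p c
  -> ~ moved p.
Proof.
move=> cc HL HR; apply: not_moved => f; have [l [r [_ sf]]] := homeo0_supported f.
pose l' := Num.min l c; pose r' := Num.max r c'.
have l'l : l' <= l by rewrite ge_min lexx.
have rr' : r <= r' by rewrite le_max lexx.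
have l'c : l' <= c by rewrite ge_min lexx orbT.
have cr' : c' <= r' by rewrite le_max lexx orbT.
apply: (@fragmentation R l' c c' r' (fun g => act g p = p)) => //.
- by move=> g h gp hp; rewrite actM hp.
- by move=> g gp; rewrite -{1}gp actK.
- exact: HL.
- exact: HR.
- exact: supported_sub sf.
Qed.

(** The centre is the supremum of the [c] with [fixed_left p c]. Compact supports stop strictly
    before it on the left, and beyond it [fixed_left_or_right] leaves only [fixed_right]. *)
Lemma centre_exists p : moved p -> exists a, fixed_left p a /\ fixed_right p a.
Proof.
move=> mp; pose A := [set c | fixed_left p c].
have A0 : A !=set0.
  apply: contrapT => nA; have [f fp] := mp; have [l [r [_ sf]]] := homeo0_supported f.
  have [Al|Rl] := fixed_left_or_right p l; first by apply: nA; exists l.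
  by apply: fp; exact: Rl sf.
have [u nu] : exists u, ~ fixed_left p u.
  apply: contrapT => nu; have [f fp] := mp; have [l [r [_ sf]]] := homeo0_supported f.
  by apply: nu; exists r => Lr; apply: fp; exact: Lr sf.
have ubA : ubound A u.
  by move=> c Ac; rewrite leNgt; apply/negP => uc; apply: nu;
    apply: fixed_left_sub Ac; exact: ltW.
have supA : has_sup A by split => //; exists u.
exists (sup A); split.
  move=> l f [c [d [lc da fid]]].
  have e0 : 0 < sup A - d by lra.
  have [x Ax] := sup_adherent e0 supA; rewrite subKr => dx.
  by apply: (Ax l); exists c, d.
move=> r f [c [d [ac dr fid]]].
pose x := (sup A + c) / 2.
have [Ax|Rx] := fixed_left_or_right p x.
  have xA : x <= sup A by apply: ub_le_sup => //; exists u.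
  by exfalso; move: xA; rewrite /x; lra.
by apply: (Rx r); exists c, d; split => //; rewrite /x; lra.
Qed.

(** Meaningful only at moved points, where such an [a] is unique by [fixed_left_right]. *)
Definition centre p : R := xget 0 [set a | fixed_left p a /\ fixed_right p a].

Lemma centreP p : moved p -> fixed_left p (centre p) /\ fixed_right p (centre p).
Proof.
move=> /centre_exists[a aP]; rewrite /centre.
by case: xgetP => [x _ //|/(_ a)]; case.
Qed.

Lemma fixed_leftE p c : moved p -> fixed_left p c <-> c <= centre p.
Proof.
move=> mp; have [Lp Rp] := centreP mp; split => [Lc|cp]; last exact: fixed_left_sub Lp.
by rewrite leNgt; apply/negP => pc; exact: fixed_left_right Lc Rp mp.
Qed.

Lemma fixed_rightE p c : moved p -> fixed_right p c <-> centre p <= c.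
Proof.
move=> mp; have [Lp Rp] := centreP mp; split => [Rc|pc]; last exact: fixed_right_sub Rp.
by rewrite leNgt; apply/negP => cp; exact: fixed_left_right Lp Rc mp.
Qed.

Lemma centre_act g p : moved p -> centre (act g p) = g (centre p).
Proof.
move=> mp; have mgp := moved_act g mp; have [Lp Rp] := centreP mp.
have conj f : act (g^-1 * f * g)%g p = p -> act f (act g p) = act g p.
  by move=> H; rewrite -{2}H !actM actVK.
apply/le_anti/andP; split.
  apply/fixed_rightE => // r f sf; apply: conj; have := supportedJ g^-1%g sf.
  by rewrite homeo0K invgK; exact: Rp.
apply/fixed_leftE => // l f sf; apply: conj; have := supportedJ g^-1%g sf.
by rewrite homeo0K invgK; exact: Lp.
Qed.

(** Common fixed sets are closed, so lying strictly below or strictly above a given value of the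
    centre is an open condition on moved points. *)
Lemma centre_continuous p : moved p -> centre x @[x --> p] --> centre p.
Proof.
move=> mp; apply/cvgrPdist_lt => e e0.
have oL c : open [set q | ~ fixed_left q c].
  have -> : [set q | ~ fixed_left q c] =
      ~` [set q | forall f, (exists l, supported l c f) -> act f q = q].
    by apply/seteqP; split => q H H'; apply: H; [move=> l f sf; apply: H'; exists l|
      move=> f [l]; exact: H'].
  exact/closed_openC/closed_common_fixed.
have oR c : open [set q | ~ fixed_right q c].
  have -> : [set q | ~ fixed_right q c] =
      ~` [set q | forall f, (exists r, supported c r f) -> act f q = q].
    by apply/seteqP; split => q H H'; apply: H; [move=> r f sf; apply: H'; exists r|
      move=> f [r]; exact: H'].
  exact/closed_openC/closed_common_fixed.
have : nbhs p (moved `&` ([set q | ~ fixed_left q (centre p + e)] `&`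
    [set q | ~ fixed_right q (centre p - e)])).
  apply: open_nbhs_nbhs; split.
    by apply: openI; [exact: open_moved|exact: openI].
  by split => //; split; rewrite /= ?fixed_leftE ?fixed_rightE //; lra.
apply: filterS => q [mq [/= nL nR]].
move: nL nR; rewrite fixed_leftE // fixed_rightE // => /negP ? /negP ?.
rewrite ltr_norml; apply/andP; split; lra.
Qed.

(** * The centre as a local homeomorphism *)

Lemma transitive (x y : R) : exists g : G, g x = y.
Proof.
pose l := Num.min x y - 1; pose r := Num.max x y + 1.
have [||||g [_ gx]] := @push R l r x y; last by exists g.
- by rewrite /l ltrBlDr gt_min; apply/orP; left; lra.
- by rewrite /r -ltrBlDr lt_max; apply/orP; left; lra.
- by rewrite /l ltrBlDr gt_min; apply/orP; right; lra.
- by rewrite /r -ltrBlDr lt_max; apply/orP; right; lra.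
Qed.

(* By equivariance every real would be a local extremum value of [centre], but a
   function on a second countable space has at most countably many of them. *)
Lemma no_local_extremum (rel : R -> R -> Prop) p O :
  (forall x y, rel x y -> rel y x -> x = y) ->
  (forall g x y, rel x y -> rel (g x) (g y)) ->
  moved p -> open O -> O p ->
  ~ (forall q, O q -> moved q -> rel (centre q) (centre p)).
Proof.
move=> rel_anti rel_act mp oO Op ext.
(* A basic set on which [y] is the extremal value determines [y], so its index would inject the
   reals into [nat]. *)
have ex y : exists n, exists q, [/\ moved q, centre q = y, b n q &
    forall q', b n q' -> moved q' -> rel (centre q') y].
  have [g gy] := transitive (centre p) y.
  have [n [bn bO]] : exists n, b n (act g p) /\ b n `<=` act g^-1%g @^-1` O.
    by apply: b_basis; [exact: act_preimage_open|rewrite /= actK].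
  exists n, (act g p); split => //; first exact: moved_act.
    by rewrite centre_act.
  move=> q' /bO /= Oq' mq'; have mq'' := moved_act g^-1%g mq'.
  by rewrite -gy -(actVK g q') centre_act //; apply: rel_act; exact: ext.
have [k kP] := choice ex; apply: (@real_uncountable R k) => x y kxy.
have [q [mq qx bq Hx]] := kP x; have [q' [mq' qy bq' Hy]] := kP y.
apply: rel_anti; first by rewrite -qx; apply: Hy; rewrite -?kxy.
by rewrite -qy; apply: Hx; rewrite ?kxy.
Qed.

(** As in Rolle's theorem, equal values at [s < t] produce an extremum strictly in between. *)
Lemma centre_chart_injective p (psi : R -> N) (s t : R) : chart p moved psi ->
  -1 < s < 1 -> -1 < t < 1 -> centre (psi s) = centre (psi t) -> s = t.
Proof.
move=> cpsi; have [psi0 psiM psic _ _] := cpsi.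
wlog st : s t / s < t => [H s1 t1 E|s1 t1 E].
  have [st|ts|//] := ltgtP s t; first exact: H.
  by apply/esym; apply: H.
exfalso; pose th x := centre (psi x).
have thc : {within `[s, t], continuous th}.
  apply: continuous_in_subspaceT => x; rewrite inE /= in_itv /= => sxt.
  have x1 : -1 < x < 1 by lra.
  by apply: continuous_comp; [exact: psic|exact/centre_continuous/psiM].
have noext (rel : R -> R -> Prop) c : (forall x y, rel x y -> rel y x -> x = y) ->
    (forall g x y, rel x y -> rel (g x) (g y)) -> s < c < t ->
    (forall x, s <= x <= t -> rel (th x) (th c)) -> False.
  move=> rel_anti rel_act sct ext.
  have c1 : -1 < c < 1 by lra.
  apply: (@no_local_extremum rel (psi c) (psi @` `]s, t[)) => //.
  - exact: psiM.
  - by apply: chart_open_itv cpsi _ _; lra.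
  - by move=> _ [x + <-] _; rewrite /= in_itv /= => sxt; apply: ext; lra.
have le_ext c : s < c < t -> (forall x, s <= x <= t -> th x <= th c) -> False.
  apply: (noext (fun x y => x <= y)) => [x y xy yx|g x y]; last by rewrite homeo0_le.
  by apply/le_anti; rewrite xy yx.
have ge_ext c : s < c < t -> (forall x, s <= x <= t -> th c <= th x) -> False.
  apply: (noext (fun x y => y <= x)) => [x y xy yx|g x y]; last by rewrite homeo0_le.
  by apply/le_anti; rewrite xy yx.
have [c + cmax] := EVT_max (ltW st) thc; rewrite in_itv /= => sct.
have [d + dmin] := EVT_min (ltW st) thc; rewrite in_itv /= => sdt.
have {}cmax x : s <= x <= t -> th x <= th c by move=> sxt; apply: cmax; rewrite in_itv.
have {}dmin x : s <= x <= t -> th d <= th x by move=> sxt; apply: dmin; rewrite in_itv.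
have ends x : s <= x <= t -> ~ (s < x < t) -> th x = th s.
  move=> sxt nsxt; have [->//|xs] := eqVneq x s; rewrite /th E; congr (centre (psi _)).
  apply: contrapT => xt; apply: nsxt; rewrite !lt_neqAle eq_sym xs.
  by case/andP: sxt => -> ->; rewrite !andbT; apply/eqP.
have [/le_ext|nc] := pselect (s < c < t); first exact.
have [/ge_ext|nd] := pselect (s < d < t); first exact.
(* With both extrema at the ends the function is constant, and the midpoint serves as an interior
   maximum. *)
apply: (le_ext ((s + t) / 2)); first lra.
move=> x /cmax; rewrite (ends _ sct nc) => /le_trans; apply.
by rewrite -(ends _ sdt nd); apply: dmin; lra.
Qed.

(** Since [p] is no local extremum, a chart contains points with larger and with smaller centre; the
    intermediate value theorem fills the gap. *)
Lemma centre_open p O : moved p -> open O -> O p ->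
  exists2 e, 0 < e & forall x, `|x - centre p| < e ->
    exists q, [/\ O q, moved q & centre q = x].
Proof.
move=> mp oO Op.
have [psi cpsi] := chartN (openI oO open_moved) (conj Op mp).
have [psi0 psiO psic _ _] := cpsi.
have oQ : open (psi @` `]-1, 1[) by apply: chart_open_itv cpsi _ _.
have Qp : (psi @` `]-1, 1[) p by exists 0; rewrite //= in_itv /=; lra.
have ex (rel : R -> R -> Prop) : (forall x y, rel x y -> rel y x -> x = y) ->
    (forall g x y, rel x y -> rel (g x) (g y)) ->
    exists2 t, -1 < t < 1 & ~ rel (centre (psi t)) (centre p).
  move=> rel_anti rel_act; apply: contrapT => nex.
  apply: (no_local_extremum rel_anti rel_act mp oQ Qp) => _ [t + <-] _.
  rewrite /= in_itv /= => t1; apply: contrapT => nrel; apply: nex; by exists t.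
have [t1 t11 /negP] : exists2 t, -1 < t < 1 & ~ (centre (psi t) <= centre p).
  apply: (ex (fun x y => x <= y)) => [x y xy yx|g x y]; last by rewrite homeo0_le.
  by apply/le_anti; rewrite xy yx.
rewrite -ltNge => pt1.
have [t2 t21 /negP] : exists2 t, -1 < t < 1 & ~ (centre p <= centre (psi t)).
  apply: (ex (fun x y => y <= x)) => [x y xy yx|g x y]; last by rewrite homeo0_le.
  by apply/le_anti; rewrite xy yx.
rewrite -ltNge => pt2.
exists (Num.min (centre (psi t1) - centre p) (centre p - centre (psi t2))).
  by rewrite lt_min !subr_gt0 pt1.
move=> x; rewrite lt_min !ltr_norml => /andP[x1 x2].
pose th t := centre (psi t).
pose lo := Num.min t1 t2; pose hi := Num.max t1 t2.
have lohi : lo <= hi by rewrite /lo /hi ge_min !le_max !lexx.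
have lo1 : -1 < lo by rewrite lt_min; lra.
have hi1 : hi < 1 by rewrite gt_max; lra.
have [||t] := @IVT R th lo hi x lohi.
- apply: continuous_in_subspaceT => t; rewrite inE /= in_itv /= => tlh.
  have t01 : -1 < t < 1 by lra.
  by apply: continuous_comp; [exact: psic|apply: centre_continuous; case: (psiO _ t01)].
- rewrite /lo /hi minElt maxElt /th; case: (ltP t1 t2) => _.
    by rewrite ge_min le_max; apply/andP; split; apply/orP; [right|left]; lra.
  by rewrite ge_min le_max; apply/andP; split; apply/orP; [left|right]; lra.
rewrite in_itv /= => tlh tx; have t01 : -1 < t < 1 by lra.
by have [Ot mt] := psiO _ t01; exists (psi t).
Qed.

Lemma local_section p : moved p -> exists a1 a2 (sg : R -> N),
  [/\ a1 < centre p < a2, sg (centre p) = p,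
      forall x, a1 < x < a2 -> moved (sg x) /\ centre (sg x) = x,
      forall x, a1 < x < a2 -> sg y @[y --> x] --> sg x &
      open (sg @` `]a1, a2[)].
Proof.
move=> mp; have [psi cpsi] := chartN open_moved mp.
have [psi0 psiM _ _ _] := cpsi.
pose Q := psi @` `]-1, 1[.
have oQ : open Q by apply: chart_open_itv cpsi _ _.
have Qp : Q p by exists 0; rewrite //= in_itv /=; lra.
have Qinj q q' : Q q -> Q q' -> centre q = centre q' -> q = q'.
  move=> [s + <-] [t + <-]; rewrite /= !in_itv /= => s1 t1 E.
  by rewrite (centre_chart_injective cpsi s1 t1 E).
have [e e0 He] := centre_open mp oQ Qp.
have ex x : exists q, `|x - centre p| < e -> [/\ Q q, moved q & centre q = x].
  have [xe|nxe] := boolP (`|x - centre p| < e); last by exists p.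
  by have [q qP] := He _ xe; exists q.
have [sg sgP] := choice ex.
have sgI x : centre p - e < x < centre p + e
  -> [/\ Q (sg x), moved (sg x) & centre (sg x) = x].
  by move=> xe; apply: sgP; rewrite ltr_norml; apply/andP; split; lra.
exists (centre p - e), (centre p + e), sg; split.
- lra.
- have [|Qs ms cs] := sgI (centre p); first lra.
  exact: Qinj.
- by move=> x /sgI[].
(* Continuity of the section is openness of [centre], given its injectivity on [Q]. *)
- move=> x xe W; rewrite nbhsE => -[W' [oW' W'x] W'W].
  have [Qx mx cx] := sgI _ xe.
  have [e' e'0 He'] := centre_open mx (openI oW' oQ) (conj W'x Qx).
  rewrite cx in He'.
  have : nbhs x (ball x e' `&` `]centre p - e, centre p + e[).
    apply: filterI; first exact: nbhsx_ballx.
    by apply: open_nbhs_nbhs; split; [exact: itv_open|rewrite /= in_itv].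
  apply: filterS => y [/= xy]; rewrite in_itv /= => ye.
  have [Qy my cy] := sgI _ ye.
  have [|q [[W'q Qq] mq cq]] := He' y; first by rewrite distrC.
  by apply: W'W; rewrite /= (Qinj (sg y) q) // cy cq.
- have -> : sg @` `]centre p - e, centre p + e[ =
      Q `&` (moved `&` [set q | centre p - e < centre q < centre p + e]).
    apply/seteqP; split => [_ [x + <-]|q [Qq [mq qe]]].
      by rewrite /= in_itv /= => xe; have [Qx mx cx] := sgI _ xe; rewrite cx.
    by exists (centre q); rewrite //= ?in_itv //; have [Qx mx cx] := sgI _ qe;
      apply: Qinj.
  apply: openI => //; rewrite openE => q [mq qe].
  have : nbhs (centre q) `]centre p - e, centre p + e[%classic.
    by apply: open_nbhs_nbhs; split; [exact: itv_open|rewrite /= in_itv].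
  move=> /(centre_continuous mq) /= near_q.
  have : nbhs q moved by apply: open_nbhs_nbhs; split => //; exact: open_moved.
  move=> nbhs_moved.
  have : nbhs q (moved `&` centre @^-1` `]centre p - e, centre p + e[)
    by exact: filterI.
  by apply: filterS => q' [mq' /=]; rewrite in_itv.
Qed.

(* Two continuous sections of [centre] that agree at one point agree. *)
Lemma section_equivariant a1 a2 (sg : R -> N) (g : G) :
  (forall x, a1 < x < a2 -> moved (sg x) /\ centre (sg x) = x) ->
  (forall x, a1 < x < a2 -> sg y @[y --> x] --> sg x) ->
  open (sg @` `]a1, a2[) -> supported a1 a2 g ->
  forall x, a1 < x < a2 -> act g (sg x) = sg (g x).
Proof.
move=> sgM sgc sgo sG.
have [g1 g2] := supported_ends sG.
have gI x : (a1 < g x < a2) = (a1 < x < a2) by rewrite -{1}g1 -{1}g2 !homeo0_lt.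
have gVI x : (a1 < g^-1%g x < a2) = (a1 < x < a2) by rewrite -gI homeo0VK.
pose u x := act g (sg (g^-1%g x)).
have uP x : a1 < x < a2 -> centre (u x) = x.
  by rewrite -gVI => /sgM[mx cx]; rewrite centre_act // cx homeo0VK.
have uc x : a1 < x < a2 -> u y @[y --> x] --> u x.
  rewrite -gVI => xI; apply: (continuous_comp (f := sg \o (g^-1)%g));
    last exact: act_continuous.
  by apply: (continuous_comp (f := (g^-1)%g)); [exact: homeo_continuous|exact: sgc].
pose I0 := `]a1, a2[%classic.
have mI x : I0 x = (a1 < x < a2) by rewrite /I0 /= in_itv.
pose E := I0 `&` [set x | u x = sg x].
suff EI : E = I0.
  move=> x; rewrite -gI => xI; have : I0 (g x) by rewrite mI.
  by rewrite -EI => -[_]; rewrite /= /u homeo0K.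
have cI : connected I0 by exact/connected_intervalP/interval_is_interval.
have oI : open I0 by exact: itv_open.
have [lt12|le21] := ltP a1 a2; last first.
  by apply/seteqP; split => x; [case|rewrite mI; lra].
apply: cI.
(* The sections [u] and [sg] agree at a point [x] left of the support of [g]: there [g] fixes
   [sg x], being supported to the right of its centre. *)
- have [c [d [a1c da2 gid]]] := sG; pose x := (a1 + Num.min c a2) / 2.
  have ma : a1 < Num.min c a2 by rewrite lt_min a1c.
  have xc : x < c by apply: (@lt_le_trans _ _ (Num.min c a2)); [rewrite /x; lra|
    rewrite ge_min lexx].
  have xa : x < a2 by apply: (@lt_le_trans _ _ (Num.min c a2)); [rewrite /x; lra|
    rewrite ge_min lexx orbT].
  have xI : a1 < x < a2 by rewrite xa andbT /x; lra.
  have gx : g^-1%g x = x by rewrite -{1}(gid x) ?homeo0K //; left; exact: ltW.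
  exists x; split; first by rewrite mI.
  rewrite /= /u gx; have [mx cx] := sgM _ xI.
  have : fixed_right (sg x) x by apply/fixed_rightE; rewrite ?cx.
  by move=> /(_ a2); apply; exists c, d.
(* Near a point of agreement [u y] lies in the open image of [sg], and comparing centres forces
   [u y = sg y]. *)
- exists E; last by rewrite /E setIA setIid.
  rewrite openE => x [Ix ux].
  have xI : a1 < x < a2 by rewrite -mI.
  have : nbhs x (I0 `&` u @^-1` (sg @` I0)).
    apply: filterI; first exact: open_nbhs_nbhs.
    by apply: uc => //; apply: open_nbhs_nbhs; split => //; rewrite ux; exists x.
  apply: filterS => y [Iy [z Iz zE]]; split => //=; rewrite -zE.
  have cz : centre (u y) = z by rewrite -zE; apply: (sgM z _).2; rewrite -mI.
  by rewrite uP -?mI // in cz; rewrite cz.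
- exists (closure E); first exact: closed_closure.
  apply/seteqP; split => [x Ex|x [Ix clx]]; first by split;
    [case: Ex|exact: subset_closure].
  split => //=; apply: contrapT => /eqP nux.
  have xI : a1 < x < a2 by rewrite -mI.
  move: hausdorffN; rewrite open_hausdorff => /(_ _ _ nux).
  move=> [[A B] /= [/set_mem Au /set_mem Bs] [oA oB /eqP AB]].
  have : nbhs x (u @^-1` A `&` sg @^-1` B).
    by apply: filterI; [apply: uc|apply: sgc] => //; exact: open_nbhs_nbhs.
  move=> /clx[y [[_ /= uy] [/= Ay By]]].
  have : (A `&` B) (u y) by split=> //; rewrite uy.
  by rewrite AB.
Qed.

(** * Stabilizers, orbits and components *)

(** Correcting [g] by [w] on the right of [a] and [v] on the left, both fixing [p], yields [k]
    fixing [d < a < c]. Cut at [c] and [d], the outer pieces fix [p] because [a] is its centre, and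
    the middle piece does by equivariance of the local section. *)
Lemma stabilizer_fixes p (g : G) : moved p -> g (centre p) = centre p -> act g p = p.
Proof.
move=> mp; set a := centre p => ga.
have [a1 [a2 [sg [/andP[a1a aa2] sga sgM sgc sgo]]]] := local_section mp.
rewrite -/a in a1a aa2 sga; have [Lp Rp] := centreP mp; rewrite -/a in Lp Rp.
(* The minimum keeps both [c] and [g c] in []a, a2[], so that [push] can bring [g c] back to [c];
   [d] is chosen symmetrically. *)
pose c := Num.min ((a + a2) / 2) (g^-1%g ((a + a2) / 2)).
have ac : a < c by rewrite lt_min homeo0_ltVr ga; apply/andP; split; lra.
have ca2 : c < a2 by rewrite gt_min; apply/orP; left; lra.
have agc : a < g c by rewrite -ga homeo0_lt.
have gca2 : g c < a2.
  have : g c <= (a + a2) / 2 by rewrite -homeo0_leVr ge_min lexx orbT.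
  lra.
have [w [sw wc]] := push agc gca2 ac ca2.
pose d := Num.max ((a1 + a) / 2) (g^-1%g ((a1 + a) / 2)).
have da : d < a by rewrite gt_max homeo0_ltVl ga; apply/andP; split; lra.
have a1d : a1 < d by rewrite lt_max; apply/orP; left; lra.
have gda : g d < a by rewrite -ga homeo0_lt.
have a1gd : a1 < g d.
  have : (a1 + a) / 2 <= g d by rewrite -homeo0_leVl le_max lexx orbT.
  lra.
have [v [sv vd]] := push a1gd gda a1d da.
have wid x : x <= a -> w x = x by move=> xa; apply: (supported_id sw); left.
have vid x : a <= x -> v x = x by move=> ax; apply: (supported_id sv); right.
pose k := (v * (w * g))%g.
have kc : k c = c by rewrite !homeo0M wc vid // ltW.
have kd : k d = d by rewrite !homeo0M wid ?vd // ltW.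
have ka : k a = a by rewrite !homeo0M ga wid // vid.
have [k1 [k2 [kE k1E k2E]]] := split_at kc.
have k1d : k1 d = d by rewrite k1E kd if_same.
have [k3 [k4 [k1E' k3E k4E]]] := split_at k1d.
have [l0 [r0 [lr0 kid]]] := homeo0_bounded k.
have k2p : act k2 p = p.
  apply: (Rp (Num.max r0 c + 1)); exists c, (Num.max r0 c); split => //; first lra.
  move=> x; rewrite k2E; case: (leP x c) => // cx [|]; first lra.
  by rewrite ge_max => /andP[rx _]; apply: kid; right.
have k3p : act k3 p = p.
  apply: (Lp (Num.min l0 d - 1)); exists (Num.min l0 d), d; split => //; first lra.
  move=> x; rewrite k3E; case: (leP x d) => // xd [|].
    rewrite le_min => /andP[xl _]; rewrite k1E; case: ifP => // _.
    by apply: kid; left.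
  by move=> dx; have -> : x = d by apply/le_anti; rewrite xd dx.
have k4p : act k4 p = p.
  have s4 : supported a1 a2 k4.
    exists d, c; split => // x xdc; rewrite k4E; case: (leP x d) => // dx.
    rewrite k1E; case: (leP x c) => // xc; case: xdc => ?; first lra.
    by have -> : x = c by apply/le_anti; rewrite xc.
  have k4a : k4 a = a by rewrite k4E leNgt da /= k1E (ltW ac).
  by rewrite -{1}sga (section_equivariant sgM sgc sgo s4) ?a1a // k4a sga.
have : act k p = p by rewrite kE k1E' !actM k2p k4p k3p.
have wp : act w p = p by exact: Rp sw.
have vp : act v p = p by exact: Lp sv.
by rewrite !actM => H; apply: (can_inj (actK w)); apply: (can_inj (actK v));
  rewrite H wp vp.
Qed.

Definition orbit p : set N := range (fun g => act g p).

Lemma orbit_refl p : orbit p p.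
Proof. by exists 1%g. Qed.

Lemma orbit_centre_injective p q q' : moved p -> orbit p q -> orbit p q' ->
  centre q = centre q' -> q = q'.
Proof.
move=> mp [g _ <-] [h _ <-]; rewrite !centre_act // => gh.
rewrite -[RHS](actVK g); congr (act g _).
rewrite -actM; apply/esym; apply: stabilizer_fixes => //.
by rewrite homeo0M -gh homeo0K.
Qed.

(** Points of one orbit are determined by their centres, so the pointwise choice [s] coincides near
    each point with a local section, which is continuous. *)
Lemma orbit_section p : moved p -> exists s : R -> N,
  [/\ forall x, orbit p (s x) /\ centre (s x) = x, continuous s & open (orbit p)].
Proof.
move=> mp.
have local q : orbit p q -> exists a1 a2 (sg : R
  -> N), [/\ a1 < centre q < a2, sg (centre q) = q,
    forall x, a1 < x < a2 -> orbit p (sg x) /\ centre (sg x) = x,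
    forall x, a1 < x < a2 -> sg y @[y --> x] --> sg x & open (sg @` `]a1, a2[)].
  move=> [g _ gq]; have mq : moved q by rewrite -gq; exact: moved_act.
  have [a1 [a2 [sg [qI sgq sgM sgc sgo]]]] := local_section mq.
  exists a1, a2, sg; split => // x xI; split; last by have [] := sgM _ xI.
  (* A local section stays in one orbit: by equivariance, an element of [Gamma a1 a2] sending
     [centre q] to [x] sends [q] to [sg x]. *)
  have /andP[a1q qa2] := qI; have /andP[a1x xa2] := xI.
  have [f [sf fx]] := push a1q qa2 a1x xa2.
  exists (f * g)%g => //.
  by rewrite actM gq -{1}sgq (section_equivariant sgM sgc sgo sf) // fx.
have ex x : exists q, orbit p q /\ centre q = x.
  have [g gx] := transitive (centre p) x.
  by exists (act g p); split; [exists g|rewrite centre_act].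
have [s sP] := choice ex.
exists s; split => //.
  move=> x; have [Ox cx] := sP x.
  have [a1 [a2 [sg [qI sgq sgO sgc sgo]]]] := local _ Ox; rewrite cx in qI sgq.
  move=> W; rewrite -sgq => /(sgc _ qI) Wnear.
  have : nbhs x (`]a1, a2[%classic `&` sg @^-1` W).
    by apply: filterI => //; apply: open_nbhs_nbhs; split; [exact: itv_open|
      rewrite /= in_itv].
  apply: filterS => y [/=]; rewrite in_itv /= => yI Wy.
  have [Oy cy] := sgO _ yI; have [Oy' cy'] := sP y.
  by rewrite (orbit_centre_injective mp Oy' Oy) // cy'.
rewrite openE => q Oq; have [a1 [a2 [sg [qI sgq sgO sgc sgo]]]] := local _ Oq.
have : nbhs q (sg @` `]a1, a2[).
  by apply: open_nbhs_nbhs; split => //; exists (centre q) => //=; rewrite in_itv.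
by apply: filterS => _ [x + <-]; rewrite /= in_itv /= => /sgO[].
Qed.

(** Orbits of moved points are open and partition the moved set, and each is connected as a
    continuous image of the line. *)
Lemma component_orbit p : moved p -> connected_component moved p = orbit p.
Proof.
move=> mp; have [s [sP sc oO]] := orbit_section mp.
have Osub q : orbit p q -> moved q by move=> [g _ <-]; exact: moved_act.
apply/seteqP; split; last first.
  apply: connected_component_max => //; first exact: orbit_refl.
  have -> : orbit p = s @` setT.
    apply/seteqP; split => [q Oq|_ [x _ <-]]; last by have [] := sP x.
    have [Os cs] := sP (centre q).
    by exists (centre q) => //; exact: orbit_centre_injective Os Oq cs.
  apply: connected_continuous_connected; last exact: continuous_subspaceT.
  by apply/connected_intervalP => x y _ _ z _.
apply: (connected_subset_clopen (B := ~` (moved `\` orbit p))) => //.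
- exact: component_connected.
- apply: open_closedC; rewrite openE => q [mq nOq].
  have [_ [_ _ oOq]] := orbit_section mq.
  have : nbhs q (orbit q) by apply: open_nbhs_nbhs; split => //; exact: orbit_refl.
  apply: filterS => q' [g _ <-]; split; first exact: moved_act.
  move=> [h _ hp]; apply: nOq; exists (g^-1 * h)%g => //.
  by rewrite actM hp actK.
- by move=> q Oq [].
- move=> q [/connected_component_sub mq nq].
  by apply: contrapT => nOq; apply: nq.
- by exists p; split; [exact: connected_component_refl|exact: orbit_refl].
Qed.

(** The homeomorphism is the orbit section, with [centre] as inverse; the conjugation formula is the
    equivariance of [centre]. *)
Lemma component_conjugation p : moved p ->
  exists h : homeo R (connected_component moved p),
  forall (f : G) (y : connected_component moved p),
    act f (set_val y) = set_val (h (f (homeo_inv h y))).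
Proof.
move=> mp; have [s [sP sc oO]] := orbit_section mp.
set I := connected_component moved p.
have IE : I = orbit p by exact: component_orbit.
have Is x : I (s x) by rewrite IE; case: (sP x).
have valI (y : I) : I (set_val y) by exact: set_mem (svalP y).
pose h x : I := exist _ (s x) (mem_set (Is x)).
pose h' (y : I) : R := centre (set_val y).
have hK : cancel h h' by move=> x; case: (sP x).
have orb_inj (y z : I) : centre (set_val y) = centre (set_val z) -> y = z.
  by move=> E; apply: val_inj; apply: (orbit_centre_injective mp _ _ E); rewrite -IE;
    exact: valI.
have h'K : cancel h' h by move=> y; apply: orb_inj; case: (sP (h' y)).
have hc : continuous h.
  move=> x A [_ [/= [W oW <-] /= Wx sub]].
  have : nbhs x (s @^-1` W) by apply: sc; apply: open_nbhs_nbhs.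
  by apply: filterS => z Wz; exact: sub.
have h'c : continuous h'.
  move=> y; apply: (continuous_comp (f := set_val)); first exact: initial_continuous.
  by apply: centre_continuous; exact: connected_component_sub (valI y).
exists (HomeoPack hc h'c hK h'K) => f y /=.
have my : moved (set_val y) by exact: connected_component_sub (valI y).
have [Os cs] := sP (f (h' y)).
apply: (orbit_centre_injective mp) => //; last by rewrite cs centre_act.
have : orbit p (set_val y) by rewrite -IE; exact: valI.
by move=> [g _ <-]; exists (f * g)%g; rewrite ?actM.
Qed.
End Action.

(** * From group morphisms to actions *)

Theorem theorem1p2 (R : realType) (N : topologicalType)
    (mN : manifold1 R N) (cN : connected [set: N])
    (phi : {multiplicative Homeo0 R R -> Homeo N}) :
  exists K : set N,
    [/\ closed K,
        forall (f : Homeo0 R R) (x : N), K x -> phi f x = x &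
        forall I : set N, is_component (~` K)%classic I ->
          exists h : homeo R I,
            forall (f : Homeo0 R R) (y : I),
              phi f (set_val y) = set_val (h (f (homeo_inv h y)))].
Proof.
have [hausN scN locN] := mN.
have [b [b_open b_basis]] := countable_basis scN.
have chartN (p : N) O : open O -> O p -> exists psi : R -> N, chart p O psi.
  move=> oO Op; have [U [V [oU Up oV [h]]]] := locN p.
  exact: chart_exists oO Op oU Up oV h.
pose act f := phi f : N -> N.
have actM f g x : act (f * g)%g x = act f (act g x) by rewrite /act gmulfM.
have phi1 : phi 1%g = 1%g by apply: (mulgI (phi 1%g)); rewrite -gmulfM !mulg1.
have act1 x : act 1%g x = x by rewrite /act phi1.
have actc f : continuous (act f) by exact: homeo_continuous.
(* [K] is the set of common fixed points of the action. *)
exists (~` moved act); split.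
- by apply: open_closedC; exact: open_moved.
- by move=> f x nx; apply: contrapT => fx; apply: nx; exists f.
- rewrite setCK => I [p mp ->].
  exact: (component_conjugation hausN chartN b_open b_basis actM act1 actc mp).
Qed.
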